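(* Consider the scalar impulsive delay differential equation $$x'(t)+a(t)x(t)=f(t,x_t)\quad (0\le t\neq t_k),\qquad \Delta x(t_k):=x(t_k^+)-x(t_k)=I_k(x(t_k))\quad (k=1,2,\dots),\tag{E}$$ in the setting described in the context. Assume: (1) there exist positive sequences $(a_k)$ and $(b_k)$ such that $b_kx^2\le x[x+I_k(x)]\le a_kx^2$ for all $x\in\mathbb{R}$, $k\in\mathbb{N}$; (2) at least one of the following two conditions (2a), (2b) holds: (2a) the sequence $P_n=\prod_{k=1}^n a_k$ is bounded, and $\int_0^\infty a(u)\,du=\infty$; (2b) the sequence $P_n=\prod_{k=1}^n a_k$ is convergent, and whenever $w:[0,\infty)\to\mathbb{R}$ is a bounded, non-oscillatory and piecewise differentiable function with $w'(t)w(t)\le 0$ on $(t_k,t_{k+1})$, $k\in\mathbb{N}$, and $\lim_{t\to\infty}w(t)=c\neq 0$, then $\int_0^\infty f(s,w_s)\,ds=-\operatorname{sgn}(c)\,\infty$; (3) there exist piecewise continuous functions $\lambda_1,\lambda_2:[0,\infty)\to[0,\infty)$ such that $$-\lambda_1(t)\mathcal{M}_t(\varphi)\le f(t,\varphi)\le\lambda_2(t)\mathcal{M}_t(-\varphi),\qquad t\ge 0,\ \varphi\in PC(t),$$ where $\mathcal{M}_t(\varphi)=\max\{0,\sup_{\theta\in[-\tau(t),0]}\varphi(\theta)\}$; (4) there exists $T>0$ with $T-\tau(T)\ge 0$ such that $\alpha_1\alpha_2<1$, where $$\alpha_i=\sup_{t\ge T}\int_{t-\tau(t)}^t\lambda_i(s)e^{-\int_s^ta(u)\,du}B(s)\,ds,\quad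 i=1,2,\qquad B(t)=\max_{\theta\in[-\tau(t),0]}\Big(\prod_{k:\,t+\theta\le t_k<t}b_k^{-1}\Big).$$ Then the zero solution of (E) is globally asymptotically stable (with respect to initial conditions in $BPC$).
   Context: Setting. $\tau:[0,\infty)\to[0,\infty)$ is continuous with $\lim_{t\to\infty}(t-\tau(t))=\infty$ and $t\mapsto t-\tau(t)$ non-decreasing. For $t\ge0$, $PC(t)=PC([-\tau(t),0];\mathbb{R})$ is the space of piecewise continuous real functions on $[-\tau(t),0]$ that are left continuous on $(-\tau(t),0]$. For a compact interval $[\alpha,\beta]$, $B([\alpha,\beta];\mathbb{R})$ is the space of bounded functions with the supremum norm and $PC([\alpha,\beta];\mathbb{R})$ its subspace of piecewise continuous functions that are left continuous on $(\alpha,\beta]$. $PC$ is the space of functions $(-\infty,0]\to\mathbb{R}$ whose restriction to each compact $[\alpha,\beta]\subset(-\infty,0]$ lies in the closure of $PC([\alpha,\beta];\mathbb{R})$ in $B([\alpha,\beta];\mathbb{R})$; $BPC$ is the set of bounded elements of $PC$, with norm $\|\varphi\|=\sup_{s\le0}|\varphi(s)|$. $(t_k)_{k\ge1}$ is an increasing sequence of positive numbers with $t_k\to\infty$; $a:[0,\infty)\to[0,\infty)$ and $I_k:\mathbb{R}\to\mathbb{R}$ are continuous, $I_k(0)=0$; $f(t,\varphi)\in\mathbb{R}$ is defined for $t\ge0$, $\varphi\in PC(t)$, with $f(t,0)=0$. In (E), $x'(t)$ is the left-hand derivative, $x$ is left continuous, and $x_t(\theta)=x(t+\theta)$ for $-\tau(t)\le\theta\le0$.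 Initial conditions are $x(t_0+s)=\varphi(s)$, $s\le0$, with $t_0\ge0$, $\varphi\in BPC$. The extension $F(t,\varphi)=f(t,\varphi|_{[-\tau(t),0]})$ of $f$ to $[0,\infty)\times BPC$ is continuous or piecewise continuous, and each such initial value problem has a unique solution $x(t,t_0,\varphi)$ on $[t_0,\infty)$. A function (or solution) is oscillatory if it is not eventually zero and has arbitrarily large zeros; otherwise it is non-oscillatory. An empty product equals 1. The divergence of $\int_0^\infty f(s,w_s)\,ds$ to $\pm\infty$ concerns large $s$ (where $s-\tau(s)\ge0$, so that $w_s$ is defined). The zero solution is stable if for every $\varepsilon>0$, $t_0\ge0$ there is $\delta=\delta(t_0,\varepsilon)>0$ such that $\varphi\in BPC$, $\|\varphi\|<\delta$ imply $|x(t,t_0,\varphi)|<\varepsilon$ for $t\ge t_0$; globally attractive if all solutions with initial conditions in $BPC$ tend to $0$ as $t\to\infty$; globally asymptotically stable if it is stable and globally attractive. *)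

(* Defs.v *)
From HB Require Import structures.
From mathcomp Require Import all_boot all_order all_algebra.
From mathcomp Require Import all_classical all_reals all_analysis.

Set Implicit Arguments.
Unset Strict Implicit.
Unset Printing Implicit Defensive.

Import Order.TTheory GRing.Theory Num.Theory.
Import numFieldNormedType.Exports.

Local Open Scope classical_set_scope.
Local Open Scope ring_scope.

(* Functions on an interval of the real line are represented by total functions
   [R -> R] whose values outside the interval are never used.  Sequences indexed
   by k = 1, 2, ... are represented by functions on [nat] shifted by one:
   [tk 0], [I_ 0], [ak 0], [bk 0] are t_1, I_1, a_1, b_1. *)

Definition piecewise_continuous_on {R : realType} (al be : R) (g : R -> R) :
    Prop :=
  [/\ exists D : seq R, forall t, t \in `[al, be] -> t \notin D ->
        g s @[s --> within `[al, be] (nbhs t)] --> g t,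
      forall t, t \in `[al, be[ -> cvg (g s @[s --> t^'+]) &
      forall t, t \in `]al, be] -> cvg (g s @[s --> t^'-])].

Definition piecewise_continuous_nneg {R : realType} (g : R -> R) : Prop :=
  forall b : R, 0 <= b -> piecewise_continuous_on 0 b g.

Definition PC_on {R : realType} (al be : R) (g : R -> R) : Prop :=
  piecewise_continuous_on al be g /\
  forall t, t \in `]al, be] -> g s @[s --> t^'-] --> g t.

(* Membership in the closure of PC([al, be]; R) for the supremum norm on
   [al, be]; such functions are automatically bounded. *)
Definition PC_closure_on {R : realType} (al be : R) (g : R -> R) : Prop :=
  forall e : R, 0 < e -> exists2 h : R -> R, PC_on al be h &
    forall s, s \in `[al, be] -> `|g s - h s| <= e.

Definition PC_at {R : realType} (tau : R -> R) (t : R) (phi : R -> R) : Prop :=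
  PC_on (- tau t) 0 phi.

Definition BPC {R : realType} (phi : R -> R) : Prop :=
  (forall al be : R, al <= be -> be <= 0 -> PC_closure_on al be phi) /\
  (exists M : R, forall s, s <= 0 -> `|phi s| <= M).

Definition bpc_norm {R : realType} (phi : R -> R) : R :=
  sup [set `|phi s| | s in `]-oo, 0]].

(* [f t phi] depends only on the restriction of [phi] to [- tau t, 0]. With this
   property, the extension F of f to [0, +oo[ x BPC is [f] itself. *)
Definition depends_on_history {R : realType} (tau : R -> R)
    (f : R -> (R -> R) -> R) : Prop :=
  forall t (phi psi : R -> R), 0 <= t ->
    (forall th, th \in `[- tau t, 0] -> phi th = psi th) -> f t phi = f t psi.

(* (Piecewise) continuity on [0, +oo[ x BPC: joint continuity, except at the
   times of a locally finite set D, where F has limits as (s, psi) tends to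
   (t, phi) with s > t and with s < t.  Continuity is the case D = set0. *)
Definition piecewise_continuous_BPC {R : realType} (F : R -> (R -> R) -> R) :
    Prop :=
  exists D : set R,
  [/\ forall b : R, finite_set (D `&` `[0, b]),
      forall t phi, 0 <= t -> ~ D t -> BPC phi ->
        forall e : R, 0 < e -> exists2 d : R, 0 < d &
          forall s psi, 0 <= s -> `|s - t| < d ->
            BPC psi -> bpc_norm (fun th => psi th - phi th) < d ->
            `|F s psi - F t phi| < e,
      forall t phi, 0 <= t -> D t -> BPC phi ->
        exists l : R, forall e : R, 0 < e -> exists2 d : R, 0 < d &
          forall s psi, t < s < t + d ->
            BPC psi -> bpc_norm (fun th => psi th - phi th) < d ->
            `|F s psi - l| < e &
      forall t phi, 0 < t -> D t -> BPC phi ->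
        exists l : R, forall e : R, 0 < e -> exists2 d : R, 0 < d &
          forall s psi, 0 <= s -> t - d < s < t ->
            BPC psi -> bpc_norm (fun th => psi th - phi th) < d ->
            `|F s psi - l| < e].

Definition has_left_derivative {R : realType} (g : R -> R) (t l : R) : Prop :=
  (g (t + h) - g t) / h @[h --> 0^'-] --> l.

Definition segment {R : realType} (x : R -> R) (t : R) : R -> R :=
  fun th => x (t + th).

(* x is a solution on [t0, +oo[ of the impulsive equation, with
   x(t0 + s) = phi(s) for s <= 0.  If t0 is an impulse time, the impulse at t0
   is applied. *)
Definition is_solution {R : realType} (a : R -> R) (f : R -> (R -> R) -> R)
    (tk : nat -> R) (I_ : nat -> R -> R) (t0 : R) (phi x : R -> R) : Prop :=
  [/\ forall s, s <= 0 -> x (t0 + s) = phi s,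
      forall t, t0 < t -> x s @[s --> t^'-] --> x t,
      forall t, t0 <= t -> (forall k, t != tk k) ->
        x s @[s --> t^'+] --> x t,
      forall k, t0 <= tk k ->
        x s - x (tk k) @[s --> (tk k)^'+] --> I_ k (x (tk k)) &
      forall t, t0 < t -> (forall k, t != tk k) ->
        exists2 d : R, has_left_derivative x t d &
          d + a t * x t = f t (segment x t)].

Definition well_posed {R : realType} (a : R -> R) (f : R -> (R -> R) -> R)
    (tk : nat -> R) (I_ : nat -> R -> R) : Prop :=
  forall (t0 : R) (phi : R -> R), 0 <= t0 -> BPC phi ->
    exists! x : R -> R, is_solution a f tk I_ t0 phi x.

Definition oscillatory {R : realType} (g : R -> R) : Prop :=
  ~ (exists t1 : R, forall t, t1 <= t -> g t = 0) /\
  (forall t1 : R, exists2 t : R, t1 <= t & g t = 0).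

(* Piecewise differentiable functions on [0, +oo[, with the regularity of
   solutions: left continuous, with breakpoints at the times t_k, and with the
   derivative understood, as in the equation, as the left-hand derivative. *)
Definition piecewise_differentiable {R : realType} (tk : nat -> R) (w : R -> R)
    : Prop :=
  (forall b : R, 0 <= b -> PC_on 0 b w) /\
  (forall t, 0 < t -> (forall k, t != tk k) ->
     w s @[s --> t] --> w t /\ exists l : R, has_left_derivative w t l).

(* The improper integral of g over [0, +oo[ is l, the lower bound 0 being
   replaced by some T0 with T0 - tau T0 >= 0. *)
Definition integral_infty_is {R : realType} (tau g : R -> R) (l : \bar R) :
    Prop :=
  exists T0 : R,
  [/\ 0 <= T0, 0 <= T0 - tau T0,
      forall u : R, T0 <= u ->
        (@lebesgue_measure R).-integrable `[T0, u] (fun s => (g s)%:E) &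
      (\int[@lebesgue_measure R]_(s in `[T0, u]) (g s)%:E)%E @[u --> +oo] --> l].

Definition diverging_integrals {R : realType} (tau : R -> R)
    (f : R -> (R -> R) -> R) (tk : nat -> R) : Prop :=
  forall (w : R -> R) (c : R),
    (exists M : R, forall t, 0 <= t -> `|w t| <= M) ->
    ~ oscillatory w ->
    piecewise_differentiable tk w ->
    (forall k t l, t \in `]tk k, tk k.+1[ -> has_left_derivative w t l ->
       l * w t <= 0) ->
    w t @[t --> +oo] --> c -> c != 0 ->
    integral_infty_is tau (fun s => f s (segment w s))
      ((- Num.sg c)%:E * +oo)%E.

Definition Mfun {R : realType} (tau : R -> R) (t : R) (phi : R -> R) : R :=
  Num.max 0 (sup [set phi th | th in `[- tau t, 0]]).

(* B(t).  The products take finitely many values when t_k -> +oo, so that the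
   supremum is a maximum. *)
Definition Bfun {R : realType} (tau : R -> R) (tk bk : nat -> R) (t : R) : R :=
  sup [set \big[*%R/1]_(k \in [set k | t + th <= tk k < t]) (bk k)^-1
      | th in `[- tau t, 0]].

Definition alpha {R : realType} (tau a : R -> R) (tk bk : nat -> R) (T : R)
    (lam : R -> R) : \bar R :=
  ereal_sup
    [set (\int[@lebesgue_measure R]_(s in `[(t - tau t)%R, t])
            (lam s * expR (- (\int[@lebesgue_measure R]_(u in `[s, t]) a u)%R)
             * Bfun tau tk bk s)%:E)%E
    | t in `[T, +oo[].

Definition zero_stable {R : realType} (a : R -> R) (f : R -> (R -> R) -> R)
    (tk : nat -> R) (I_ : nat -> R -> R) : Prop :=
  forall e t0 : R, 0 < e -> 0 <= t0 ->
    exists2 d : R, 0 < d &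
      forall phi x : R -> R, BPC phi -> bpc_norm phi < d ->
        is_solution a f tk I_ t0 phi x ->
        forall t, t0 <= t -> `|x t| < e.

Definition globally_attractive {R : realType} (a : R -> R)
    (f : R -> (R -> R) -> R) (tk : nat -> R) (I_ : nat -> R -> R) : Prop :=
  forall (t0 : R) (phi x : R -> R), 0 <= t0 -> BPC phi ->
    is_solution a f tk I_ t0 phi x -> x t @[t --> +oo] --> (0 : R).

Definition globally_asymptotically_stable {R : realType} (a : R -> R)
    (f : R -> (R -> R) -> R) (tk : nat -> R) (I_ : nat -> R -> R) : Prop :=
  zero_stable a f tk I_ /\ globally_attractive a f tk I_.

(* Main.v *)
Require Import Defs.
From HB Require Import structures.
From mathcomp Require Import all_boot all_order all_algebra.
From mathcomp Require Import all_classical all_reals all_analysis.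
From mathcomp Require Import measurable_realfun.
From mathcomp Require Import ring lra.

(** Let c_k = (x(t_k) + I_k(x(t_k))) / x(t_k) be the jump ratios of a solution x
    and Q(t) the product of the c_k with t_k < t.  Since b_k <= c_k <= a_k, the
    ratios are positive, and the quotient y = x / Q is continuous: the impulses
    have disappeared ([impulse_free_continuous]).  The products of the a_k are
    bounded, so it is enough to control y.  Rewriting the equation in terms of y
    costs quotients Q(s + th) / Q(s), which are products of 1 / c_k over the
    window of s and are bounded by B(s).  Hence, if N >= 0 and y >= - N on that
    window, then y' + a y <= lam2 B N at s, and symmetrically for - y with lam1
    ([impulse_free_delay_inequality]).

    A function subject to this pair of inequalities cannot climb freely.  Suppose
    that y exceeds a level c >= 0.  If y was nonnegative on the whole window, then
    N = 0 is allowed and y decreases.  If it was nonpositive at some time r of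
    the window, variation of constants from r on gives y <= alpha2 N, where - N is
    a lower bound of y ([delay_peak]).  So y never crosses a level c >= alpha2 N
    upwards ([delay_stays_below]).  As alpha1 alpha2 <= 1, suitable upper and lower
    bounds of y confirm each other forever ([delay_trap]); together with a crude
    growth estimate for the times whose windows still meet the initial function
    ([delay_growth]) this is stability.  If y takes values <= 0 and values >= 0 at
    arbitrarily late times, alternating the argument for y and - y multiplies an
    eventual bound by alpha1 alpha2 < 1 again and again, so that y tends to 0
    ([delay_oscillation_vanishes]).

    In the remaining case y has a constant sign at late times.  Then f opposes that
    sign and e^A |y| is nonincreasing, A being a primitive of a
    ([signed_nonincreasing]).  If the integral of a diverges, y tends to 0.  If the
    products of the a_k converge, x has a limit c ([signed_solution_cvg]).  If c
    were not 0, the integral of f along x would diverge; but |f| <= - M d|y|/dt for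
    some constant M, and by Fatou this bounds the integral of |f| by a multiple of
    the decrease of |y| ([left_derivative_integral_bound], [limit_zero]).

    The derivatives of solutions are left derivatives and the estimates fail on a
    countable set of times.  Both are absorbed by [threshold_growth], a mean value
    inequality from which all growth estimates for y are derived. *)

Set Implicit Arguments.
Unset Strict Implicit.
Unset Printing Implicit Defensive.

Import Order.TTheory GRing.Theory Num.Theory.
Import numFieldNormedType.Exports.

Local Open Scope classical_set_scope.
Local Open Scope ring_scope.

(** * Left derivatives and growth *)

Lemma countable_setU (T : Type) (A B : set T) :
  countable A -> countable B -> countable (A `|` B).
Proof.
move=> cA cB; have -> : A `|` B = \bigcup_(b in [set: bool]) (if b then A else B).
  by apply/seteqP; split=> [x [Ax|Bx]|x [[] _ ?]];
    [exists true|exists false|left|right].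
by apply: bigcup_countable => // -[].
Qed.

Section left_derivative.
Context {R : realType}.
Implicit Types (f g : R -> R) (t l : R).

Lemma cvg_near_eq (T : Type) (F : set_system T) {FF : Filter F} (f g : T -> R) l :
  f x @[x --> F] --> l -> (\forall x \near F, f x = g x) ->
  g x @[x --> F] --> l.
Proof. by move=> fl fg; apply: cvg_trans fl; exact: near_eq_cvg. Qed.

Lemma near_left_increment t (P : R -> Prop) :
  (\forall s \near t^'-, P s) <-> (\forall h \near 0^'-, P (t + h)).
Proof.
split=> -[e /= e0 H]; exists e => //= h /= he h0.
- apply: H => /=; last by rewrite gtrDl.
  by move: he; rewrite sub0r normrN opprD addNKr normrN.
- rewrite -(subrKC t h); apply: H => /=; last by rewrite subr_lt0.
  by rewrite sub0r normrN distrC.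
Qed.

Lemma has_left_derivative_eq_near f g t l :
  (\forall s \near t^'-, f s = g s) -> f t = g t ->
  has_left_derivative f t l -> has_left_derivative g t l.
Proof.
move=> fg ft; apply: cvg_trans; apply: near_eq_cvg.
move/near_left_increment : fg; apply: filterS => h fgh.
by rewrite fgh ft.
Qed.

Lemma has_left_derivative_unique f t l l' :
  has_left_derivative f t l -> has_left_derivative f t l' -> l = l'.
Proof. by move=> h h'; apply: (cvg_unique _ h h'). Qed.

Lemma has_left_derivativeN f t l :
  has_left_derivative f t l -> has_left_derivative (fun s => - f s) t (- l).
Proof.
rewrite /has_left_derivative => /cvgN; apply: cvg_trans; apply: near_eq_cvg.
by near=> h; rewrite -opprD mulNr.
Unshelve. all: by end_near. Qed.

Lemma has_left_derivative_lim f t l :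
  has_left_derivative f t l -> f (t + h) @[h --> 0^'-] --> f t.
Proof.
move=> fl; have h0 : h @[h --> (0:R)^'-] --> (0:R) by exact: (@cvg_at_left_filter _ _ id (0:R) 0 cvg_id).
pose proof (cvgD (cvg_cst (f t)) (cvgM fl h0)) as H.
rewrite mulr0 addr0 in H; apply: (cvg_near_eq H); near=> h.
have hn0 : h != 0 by near: h; exact: (nbhs_left_neq (0:R)).
by rewrite /= /cst mulfVK// subrKC.
Unshelve. all: by end_near. Qed.

Lemma has_left_derivativeM f g t l m :
  has_left_derivative f t l -> has_left_derivative g t m ->
  has_left_derivative (fun s => f s * g s) t (l * g t + f t * m).
Proof.
move=> fl gm; have gt := has_left_derivative_lim gm.
pose proof (cvgD (cvgM fl gt) (cvgM (cvg_cst (f t)) gm)) as H.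
apply: (cvg_near_eq H); near=> h.
by rewrite /= /cst; ring.
Unshelve. all: by end_near. Qed.

Lemma has_left_derivativeD f g t l m :
  has_left_derivative f t l -> has_left_derivative g t m ->
  has_left_derivative (fun s => f s + g s) t (l + m).
Proof.
move=> fl gm; pose proof (cvgD fl gm) as H.
by apply: (cvg_near_eq H); near=> h; rewrite /=; ring.
Unshelve. all: by end_near. Qed.

Lemma has_left_derivativeMr f t l k :
  has_left_derivative f t l -> has_left_derivative (fun s => f s * k) t (l * k).
Proof.
move=> fl; pose proof (cvgM fl (cvg_cst k)) as H.
apply: (cvg_near_eq H); near=> h.
by rewrite /= /cst; ring.
Unshelve. all: by end_near. Qed.

Lemma is_derive_derive1 f t l :
  derivable f t 1 -> derive1 f t = l -> is_derive t 1 f l.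
Proof. by move=> df <-; rewrite derive1E; exact: derivableP. Qed.

Lemma derivable_has_left_derivative f t :
  derivable f t 1 -> has_left_derivative f t (derive1 f t).
Proof.
move=> df; have : (fun h => h^-1 *: (f (h *: 1 + t) - f t)) @ 0^' --> derive1 f t.
  by rewrite derive1E; exact: df.
move=> /cvg_dnbhs_at_left H; apply: (cvg_near_eq H); near=> h.
by rewrite /= /GRing.scale/= mulr1 (addrC h) mulrC.
Unshelve. all: by end_near. Qed.

(** If the bound failed at t, then for some e > 0 the function
    u(r) = f(r) - c - (C + e)(r - s) would be positive at t.  Choose a level eta
    in ]0, u(t)[ outside the countable set u(E), and let r0 be the first time at
    which u reaches eta.  Then r0 is not in E and f(r0) > c, while u < eta before
    r0 forces a left derivative of f at r0 of at least C + e.  The derivative has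
    to be controlled only where f exceeds c, which is what makes the delay
    inequalities below usable. *)
Lemma threshold_growth (E : set R) f s t c C : countable E ->
  s <= t -> 0 <= C -> f s <= c ->
  (forall r, s <= r < t -> f x @[x --> r^'+] --> f r) ->
  (forall r, s < r <= t -> f x @[x --> r^'-] --> f r) ->
  (forall r, s < r <= t -> ~ E r -> c < f r ->
    exists2 l, has_left_derivative f r l & l <= C) ->
  f t <= c + C * (t - s).
Proof.
move=> cE st C0 fs fr fl fd; rewrite leNgt; apply/negP => ft.
have {}st : s < t.
  rewrite lt_neqAle st andbT; apply/eqP => ste; move: ft.
  by rewrite -ste subrr mulr0 addr0 ltNge fs.
have ts0 : 0 < t - s by rewrite subr_gt0.
pose e := (f t - (c + C * (t - s))) / (2 * (t - s)).
have e0 : 0 < e by rewrite divr_gt0 ?subr_gt0 ?mulr_gt0.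
pose u r := f r - c - (C + e) * (r - s).
have ut : 0 < u t.
  have -> : u t = e * (t - s).
    by rewrite /u /e; field; rewrite gt_eqF.
  by rewrite mulr_gt0.
have us : u s <= 0 by rewrite /u subrr mulr0 subr0 subr_le0.
have [eta /andP[eta0 etat] etaE] : exists2 eta, 0 < eta < u t & ~ (u @` E) eta.
  apply: contrapT => H.
  (* otherwise an interval of positive length would be countable *)
  have : `]0, u t[ `<=` u @` E.
    move=> z /=; rewrite in_itv/= => zut; apply: contrapT => zE.
    by apply: H; exists z.
  move=> /subset_card_le; rewrite -/(_ #<= _)%card => /card_le_trans/(_ (card_image_le _ _)).
  move=> /sub_countable/(_ cE)/countable_lebesgue_measure0.
  rewrite lebesgue_measure_itv/= lte_fin ut -EFinD subr0 => -[u0].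
  by move: ut; rewrite u0 ltxx.
pose S := [set r | s <= r <= t /\ eta <= u r].
have St : S t by split; rewrite ?(ltW st) ?lexx// ltW.
have lbS : lbound S s by move=> r [/andP[]].
have iS : has_inf S by split; [exists t|exists s].
set r0 := inf S.
have sr0 : s <= r0 by apply: lb_le_inf => //; exists t.
have r0t : r0 <= t by apply: ge_inf => //; exists s.
have ulim : forall r (F : set_system R), Filter F -> f x @[x --> F] --> f r ->
    x @[x --> F] --> r -> u x @[x --> F] --> u r.
  move=> r F FF h1 h2; apply: cvgB.
    by apply: cvgB => //; exact: cvg_cst.
  by apply: cvgMr; apply: cvgB => //; exact: cvg_cst.
have ur0 : eta <= u r0.
  rewrite leNgt; apply/negP => ur0.
  have r0t' : r0 < t.
    rewrite lt_neqAle r0t andbT; apply/eqP => r0t'.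
    by move: ur0; rewrite r0t' ltNge (ltW etat).
  have /(@cvgr_lt _ _ _ _ _ _)/(_ _ ur0) : u x @[x --> r0^'+] --> u r0.
    by apply: ulim; [apply: fr; rewrite sr0|exact: (@cvg_at_right_filter _ _ id)].
  case=> d /= d0 H.
  have [r Sr rd] := @inf_adherent _ S d d0 iS.
  have r0r : r0 <= r by apply: ge_inf => //; exists s.
  have [r0r'|rr0] := eqVneq r0 r.
    by move: ur0; rewrite r0r' ltNge Sr.2.
  have : u r < eta.
    apply: H; last by rewrite lt_neqAle rr0.
    by rewrite /= ler0_norm ?subr_le0// opprB ltrBlDl.
  by rewrite ltNge Sr.2.
have sr0' : s < r0.
  rewrite lt_neqAle sr0 andbT; apply/eqP => sr.
  by move: ur0; rewrite -sr leNgt (le_lt_trans us).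
have ult r : s <= r -> r < r0 -> u r < eta.
  move=> sr rr0; rewrite ltNge; apply/negP => ur; have : r0 <= r.
    by apply: ge_inf; [exists s|split=> //; rewrite sr ltW// (lt_le_trans rr0)].
  by rewrite leNgt rr0.
have ur0' : u r0 <= eta.
  have ucv : u x @[x --> r0^'-] --> u r0.
    by apply: ulim; [apply: fl; rewrite sr0'|exact: (@cvg_at_left_filter _ _ id)].
  apply: (@closed_cvg _ _ _ _ u (fun z => z <= eta) _ _ _ ucv).
    exact: closed_le.
  near=> r; apply/ltW/ult.
    by near: r; exact: (nbhs_left_ge sr0').
  by near: r; exact: (nbhs_left_lt r0).
have ur : u r0 = eta by apply/eqP; rewrite eq_le ur0 ur0'.
have Er0 : ~ E r0 by move=> Er0; apply: etaE; exists r0.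
have cfr0 : c < f r0.
  have : 0 < u r0 by rewrite ur.
  rewrite /u -addrA -opprD subr_gt0; apply: le_lt_trans.
  by rewrite lerDl mulr_ge0 ?subr_ge0// addr_ge0// ltW.
have [|l fl' lC] := fd r0 _ Er0 cfr0; first by rewrite sr0'.
have lCe : l < C + e by rewrite (le_lt_trans lC)// ltrDl.
have H : \forall r \near r0^'-, (f (r0 + (r - r0)) - f r0) / (r - r0) < C + e.
  apply/near_left_increment; pose proof (cvgr_lt _ fl' _ lCe) as H.
  by apply: filterS H => h; rewrite (addrC r0 h) addrK addrC.
have : \forall r \near r0^'-, False.
  near=> r.
  have rr0 : r < r0 by near: r; exact: (nbhs_left_lt r0).
  have sr : s <= r by near: r; exact: (nbhs_left_ge sr0').
  have : (f (r0 + (r - r0)) - f r0) / (r - r0) < C + e by near: r; exact: H.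
  rewrite subrKC ltr_ndivrMr ?subr_lt0// => H'.
  have := ult r sr rr0; rewrite -ur /u; lra.
by move/filter_ex => [].
Unshelve. all: by end_near. Qed.

End left_derivative.

(** * One-sided continuity and primitives *)

Section continuous_from.
Context {R : realType}.
Implicit Types (f g : R -> R).

(** Nothing is required from the left at t0, where a solution is given by its
    initial function. *)
Definition continuous_from (t0 : R) f : Prop :=
  (forall t, t0 <= t -> f s @[s --> t^'+] --> f t) /\
  (forall t, t0 < t -> f s @[s --> t^'-] --> f t).

Lemma continuous_fromN t0 f : continuous_from t0 f ->
  continuous_from t0 (fun s => - f s).
Proof. by move=> [fr fl]; split=> t tt; apply: cvgN; [exact: fr|exact: fl]. Qed.

Lemma within_continuous_from f t0 a b : t0 <= a -> continuous_from t0 f ->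
  {within `[a, b], continuous f}.
Proof.
move=> t0a [fr fl]; have [ab|ba|<-] := ltgtP a b; last 2 first.
- by rewrite set_itv_ge ?bnd_simp -?ltNge//; exact: continuous_subspace0.
- by rewrite set_itv1; exact: continuous_subspace1.
apply/continuous_within_itvP => //; split.
- move=> x; rewrite in_itv/= => /andP[ax xb].
  apply/left_right_continuousP; split; first exact/fl/(le_lt_trans t0a).
  exact/fr/(le_trans t0a)/ltW.
- exact: fr.
- exact/fl/(le_lt_trans t0a).
Qed.

Lemma continuous_from_within f t0 : {within `[t0, +oo[, continuous f} ->
  continuous_from t0 f.
Proof.
move=> /continuous_within_itvcyP[fo fr]; split=> t; last first.
  by move=> tt; apply: cvg_at_left_filter; apply: fo; rewrite in_itv/= tt.
rewrite le_eqVlt => /predU1P[<-//|tt].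
by apply: cvg_at_right_filter; apply: fo; rewrite in_itv/= tt.
Qed.

End continuous_from.

Lemma has_left_derivative_expR {R : realType} (f : R -> R) (c t l : R) :
  derivable f t 1 -> derive1 f t = l ->
  has_left_derivative (fun s => expR (f s - c)) t (l * expR (f t - c)).
Proof.
move=> df f't; have df' : is_derive t 1 f l by exact: is_derive_derive1.
have dg : is_derive t 1 (fun s => f s - c) l.
  by have := is_deriveB df' (is_derive_cst c t 1); rewrite subr0.
have dE : is_derive t 1 (fun s => expR (f s - c)) (l * expR (f t - c)).
  have := @is_derive1_comp _ expR (fun s => f s - c) t _ _ (is_derive_expR _) dg.
  by rewrite mulrC.
have -> : l * expR (f t - c) = derive1 (fun s => expR (f s - c)) t.
  by rewrite derive1E derive_val.
by apply: derivable_has_left_derivative; case: dE.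
Qed.

Section integral_function.
Context {R : realType}.
Notation mu := (@lebesgue_measure R).
Variable a : R -> R.
Hypothesis a_ge0 : forall t : R, 0 <= t -> 0 <= a t.
Hypothesis a_cont : {within `[0, +oo[, continuous a}.

Definition primitive0 t := \int[mu]_(u in `[0, t]) a u.
Local Notation A := primitive0.

Lemma within_nneg s t : 0 <= s -> {within `[s, t], continuous a}.
Proof.
by move=> s0; apply: (within_continuous_from s0); exact: continuous_from_within.
Qed.

Lemma integrable_nneg s t : 0 <= s -> mu.-integrable `[s, t] (EFin \o a).
Proof.
move=> s0; apply: continuous_compact_integrable; first exact: segment_compact.
exact: within_nneg.
Qed.

Lemma continuous_at_pos t : 0 < t -> {for t, continuous a}.
Proof.
move=> t0; have /continuous_within_itvcyP[+ _] := a_cont.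
by apply; rewrite in_itv/= t0.
Qed.

Lemma primitive0_derive t : 0 < t -> derivable A t 1 /\ derive1 A t = a t.
Proof.
move=> t0; apply: (@continuous_FTC1_closed _ _ _ _ (t + 1)) => //.
- by rewrite ltrDl.
- exact: integrable_nneg.
- exact: continuous_at_pos.
Qed.

Lemma primitive0_sub s t : 0 <= s <= t ->
  \int[mu]_(u in `[s, t]) a u = A t - A s.
Proof.
move=> /andP[s0 st]; rewrite /A Rintegral_itvB ?bnd_simp//; last first.
  exact: integrable_nneg.
rewrite Rintegral_itv_obnd_cbnd//; apply: integrableS (integrable_nneg t s0) => //.
by apply: subset_itvr; rewrite bnd_simp.
Qed.

Lemma primitive0_le s t : 0 <= s <= t -> A s <= A t.
Proof.
move=> /[dup] /andP[s0 st] st'; rewrite -subr_ge0 -primitive0_sub//.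
apply: Rintegral_ge0 => x /=; rewrite in_itv/= => /andP[sx _].
exact/a_ge0/(le_trans s0).
Qed.

Lemma primitive0_continuous : continuous_from 0 A.
Proof.
have cA b : 0 <= b -> {within `[0, b], continuous A}.
  by move=> b0; apply: parameterized_integral_continuous => //; exact: integrable_nneg.
split=> t t0.
  have /continuous_within_itvP[|Ao Ar _] := cA (t + 1) (addr_ge0 t0 ler01).
    by rewrite ltr_wpDl.
  move: t0; rewrite le_eqVlt => /predU1P[<-//|t0].
  by apply: cvg_at_right_filter; apply: Ao; rewrite in_itv/= t0 ltrDl ltr01.
by have /(continuous_within_itvP _ t0)[] := cA t (ltW t0).
Qed.

Lemma expR_primitive0_left_derivative c t : 0 < t ->
  has_left_derivative (fun s => expR (A s - c)) t (a t * expR (A t - c)).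
Proof.
by move=> t0; have [dA A't] := primitive0_derive t0; exact: has_left_derivative_expR.
Qed.

Lemma expR_primitive0_continuous c : continuous_from 0 (fun s => expR (A s - c)).
Proof.
have [Ar Al] := primitive0_continuous; split=> t t0.
  apply: (continuous_cvg _ (@continuous_expR R _)).
  by apply: cvgB; [exact: Ar|exact: cvg_cst].
apply: (continuous_cvg _ (@continuous_expR R _)).
by apply: cvgB; [exact: Al|exact: cvg_cst].
Qed.

(** A bounded primitive of a nonnegative function converges, and its limit is
    the integral over the half-line. *)
Lemma primitive0_unbounded : (\int[mu]_(u in `[0%R, +oo[) (a u)%:E = +oo)%E ->
  forall M, exists2 t, 0 <= t & forall s, t <= s -> M <= A s.
Proof.
move=> aoo M; apply: contrapT => H.
have AM t : 0 <= t -> A t <= M.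
  move=> t0; rewrite leNgt; apply/negP => MA; apply: H; exists t => // s ts.
  by rewrite (le_trans (ltW MA))// primitive0_le// t0.
have ndA : {homo (fun t => A (Num.max 0 t)) : x y / x <= y}.
  move=> x y xy; apply: primitive0_le; rewrite le_max lexx/=.
  by rewrite ge_max !le_max lexx xy orbT.
have ubA : has_ubound (range (fun t => A (Num.max 0 t))).
  by exists M => _ [t _ <-]; apply: AM; rewrite le_max lexx.
have [l Al] : exists l : R, A t @[t --> +oo] --> l.
  pose proof (nondecreasing_cvgr ndA ubA) as H1.
  exists (sup (range (fun t => A (Num.max 0 t)))).
  apply: (cvg_near_eq H1); near=> t.
  by rewrite max_r//; near: t; exact: (nbhs_pinfty_ge (num_real (0:R))).
have := @ge0_continuous_FTC2y _ a A 0 l a_ge0 a_cont Al.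
rewrite aoo => H1.
have /H1 : forall x, 0 < x -> derivable A x 1 by move=> x /primitive0_derive[].
move=> /(_ (primitive0_continuous.1 _ (lexx _))).
have H2 : {in `]0, +oo[, derive1 A =1 a}.
  by move=> x; rewrite in_itv/= andbT => /primitive0_derive[].
by move=> /(_ H2).
Unshelve. all: by end_near. Qed.

End integral_function.

(** * A scalar delay inequality *)

Section delay_inequality.
Context {R : realType}.
Notation mu := (@lebesgue_measure R).
Variables (tau a : R -> R) (T t0 : R) (E : set R).
Hypothesis t0_ge0 : 0 <= t0.
Hypothesis tau_ge0 : forall t : R, 0 <= t -> 0 <= tau t.
Hypothesis tau_mono : forall s t : R, 0 <= s -> s <= t -> s - tau s <= t - tau t.
Hypothesis tau_lim : t - tau t @[t --> +oo] --> +oo.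
Hypothesis a_ge0 : forall t : R, 0 <= t -> 0 <= a t.
Hypothesis a_cont : {within `[0, +oo[, continuous a}.
Hypothesis T_ge0 : 0 <= T.
Hypothesis T_tau : 0 <= T - tau T.
Hypothesis E_countable : countable E.
Local Notation A := (primitive0 a).

(** For N = 0 this says that y cannot grow when it was nonnegative on its whole
    window.  The pair of inequalities for y and - y replaces the two-sided bound
    on the delayed term. *)
Definition delay_inequality (L y : R -> R) : Prop :=
  forall s, t0 < s -> ~ E s -> exists2 d, has_left_derivative y s d &
    forall N, 0 <= N -> (forall r, s - tau s <= r <= s -> - N <= y r) ->
      d + a s * y s <= L s * N.

(** Outside E the gain is continuous, so that its primitives can be
    differentiated there. *)
Definition admissible_gain (L : R -> R) (al : R) : Prop :=
  [/\ forall t, 0 <= t -> 0 <= L t,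
      forall t, 0 < t -> ~ E t -> {for t, continuous L},
      forall b : R, measurable_fun `[0, b] L &
      forall t, T <= t ->
        (\int[mu]_(s in `[(t - tau t)%R, t])
          (L s * expR (- \int[mu]_(u in `[s, t]) a u)%R)%:E <= al%:E)%E].

Lemma gain_ge0 L al : admissible_gain L al -> 0 <= al.
Proof.
move=> [L0 _ _ Lal]; rewrite -lee_fin; apply: le_trans (Lal T (lexx _)).
apply: integral_ge0 => s /=; rewrite in_itv/= => /andP[Ts _].
by rewrite lee_fin mulr_ge0 ?expR_ge0// L0// (le_trans T_tau).
Qed.

(** Variation of constants from r, where y is nonpositive, bounds y s by N times
    the integral of L u * exp (- int_u^s a) over [r, s], and this interval lies in
    the window of s.  The comparison is [threshold_growth] for
    exp (A - A s) * y - N * K, with K the primitive of the integrand. *)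
Lemma delay_peak L al y S r s N : admissible_gain L al ->
  delay_inequality L y -> continuous_from t0 y ->
  t0 <= S -> S <= r -> T <= s -> s - tau s <= r <= s -> 0 <= N ->
  (forall v, S - tau S <= v <= s -> - N <= y v) ->
  y r <= 0 -> y s <= al * N.
Proof.
move=> adm dy cy t0S Sr Ts /andP[sr rs] N0 yN yr.
have al0 := gain_ge0 adm; case: adm => L0 Lc Lm Lal.
move: rs; rewrite le_eqVlt => /predU1P[<-|rs].
  by rewrite (le_trans yr)// mulr_ge0.
have t0r : t0 <= r by rewrite (le_trans t0S).
have r0 : 0 <= r by rewrite (le_trans t0_ge0).
have s0 : 0 <= s by rewrite (le_trans r0)// ltW.
pose k u := L u * expR (A u - A s).
have k0 u : 0 <= u -> 0 <= k u by move=> u0; rewrite mulr_ge0 ?expR_ge0 ?L0.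
have Tss : 0 <= s - tau s by rewrite (le_trans T_tau)// tau_mono.
have mk : measurable_fun `[0, s] k.
  apply: measurable_funM => //.
  apply: subspace_continuous_measurable_fun => //.
  apply: (@within_continuous_from _ _ 0) => //.
  exact: expR_primitive0_continuous.
have kal : (\int[mu]_(u in `[r, s]) (k u)%:E <= al%:E)%E.
  apply: le_trans (Lal s Ts).
  rewrite [leRHS](_ : _ = \int[mu]_(u in `[(s - tau s)%R, s]) (k u)%:E)%E.
    apply: ge0_subset_integral => //=.
    - apply/measurable_EFinP; apply: measurable_funS mk => //.
      by apply: subset_itvr; rewrite bnd_simp.
    - move=> u; rewrite in_itv/= => /andP[su _].
      by rewrite lee_fin k0// (le_trans Tss).
    - by apply: subset_itvr; rewrite bnd_simp.
  apply: eq_integral => u; rewrite inE/= in_itv/= => /andP[su us].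
  by rewrite /k (primitive0_sub a_cont) ?opprB// us (le_trans Tss).
have ik : mu.-integrable `[r, s] (EFin \o k).
  apply/integrableP; split.
    apply/measurable_EFinP; apply: measurable_funS mk => //.
    by apply: subset_itvr; rewrite bnd_simp.
  apply: le_lt_trans (ltry al); apply: le_trans kal.
  rewrite le_eqVlt; apply/orP; left; apply/eqP; apply: eq_integral => u.
  rewrite inE/= in_itv/= => /andP[ru _].
  by rewrite ger0_norm ?k0// (le_trans r0).
pose K v := \int[mu]_(u in `[r, v]) k u.
have Kal : K s <= al.
  have fK : (\int[mu]_(u in `[r, s]) (k u)%:E)%E \is a fin_num.
    exact: integrable_fin_num ik.
  by rewrite -lee_fin /K /Rintegral fineK.
have cK : {within `[r, s], continuous K}.
  by apply: parameterized_integral_continuous => //; exact: ltW.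
have [cKo cKr cKl] := (continuous_within_itvP _ rs).1 cK.
pose e v := expR (A v - A s).
have [er el] : continuous_from 0 e by exact: expR_primitive0_continuous.
have [yr' yl] := cy.
suff : e s * y s - K s * N <= 0 + 0 * (s - r).
  rewrite /e subrr expR0 mul1r mul0r addr0 subr_le0 => /le_trans; apply.
  by rewrite ler_wpM2r.
(* K is differentiable inside [r, s] only, so that s joins the exceptional set *)
apply: (@threshold_growth _ (E `|` [set s]) (fun v => e v * y v - K v * N)) => //.
- by apply: countable_setU => //; exact: countable1.
- exact: ltW.
- rewrite /K set_itv1 Rintegral_set1 mul0r subr0.
  by rewrite pmulr_rle0 ?expR_gt0.
- move=> v /andP[rv vs]; apply: cvgB; apply: cvgM; first 2 last.
  + move: rv; rewrite le_eqVlt => /predU1P[<-//|rv].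
    by apply: cvg_at_right_filter; apply: cKo; rewrite in_itv/= rv.
  + exact: cvg_cst.
  + by apply: er; rewrite (le_trans r0).
  + by apply: yr'; rewrite (le_trans t0r).
- move=> v /andP[rv vs]; apply: cvgB; apply: cvgM; first 2 last.
  + move: vs; rewrite le_eqVlt => /predU1P[->//|vs].
    by apply: cvg_at_left_filter; apply: cKo; rewrite in_itv/= rv.
  + exact: cvg_cst.
  + by apply: el; rewrite (le_lt_trans r0).
  + by apply: yl; rewrite (le_lt_trans t0r).
- move=> v /andP[rv vs] /not_orP[Ev /eqP vns] _.
  have {}vs : v < s by rewrite lt_neqAle vs andbT.
  have t0v : t0 < v by rewrite (le_lt_trans t0r).
  have v0 : 0 < v by rewrite (le_lt_trans r0).
  have [d yd dN] := dy v t0v Ev.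
  have ev := @expR_primitive0_left_derivative _ _ a_cont (A s) _ v0.
  have [K1 K2] : derivable K v 1 /\ derive1 K v = k v.
    apply: (@continuous_FTC1_closed _ _ _ _ s) => //.
    apply: cvgM; first exact: Lc.
    by apply/left_right_continuousP; split; [exact: el|exact/er/ltW].
  have := derivable_has_left_derivative K1; rewrite K2 => Kv.
  eexists.
    apply: has_left_derivativeD; first exact: has_left_derivativeM ev yd.
    by apply: has_left_derivativeN; apply: has_left_derivativeMr; exact: Kv.
  rewrite /k -/(e v).
  have -> : a v * e v * y v + e v * d - L v * e v * N =
    e v * (d + a v * y v - L v * N) by ring.
  rewrite pmulr_rle0 ?expR_gt0// subr_le0; apply: dN => // w /andP[vw wv].
  apply: yN; rewrite (le_trans wv (ltW vs)) andbT (le_trans _ vw)// tau_mono//.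
    by rewrite (le_trans t0_ge0).
  by rewrite (le_trans Sr)// ltW.
Qed.

(** At a time v with y v > c there are two possibilities.  If y is nonnegative on
    the window of v, the inequality with N = 0 makes y decrease at v.  Otherwise y
    was negative in the window and [delay_peak] gives y v <= al * N <= c. *)
Lemma delay_stays_below L al y S t1 t2 N c : admissible_gain L al ->
  delay_inequality L y -> continuous_from t0 y ->
  t0 <= S -> S <= t1 - tau t1 -> T <= t1 -> t1 <= t2 -> 0 <= N ->
  (forall v, S - tau S <= v <= t2 -> - N <= y v) ->
  al * N <= c -> y t1 <= c -> y t2 <= c.
Proof.
move=> adm dy cy t0S St1 Tt1 t12 N0 yN alc yt1.
have al0 := gain_ge0 adm.
have c0 : 0 <= c by rewrite (le_trans _ alc)// mulr_ge0.
have S0 : 0 <= S by rewrite (le_trans t0_ge0).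
have t10 : 0 <= t1 by rewrite (le_trans T_ge0).
have St1' : S <= t1 by rewrite (le_trans St1)// gerBl tau_ge0.
have t01 : t0 <= t1 by rewrite (le_trans t0S).
have [yr yl] := cy.
suff : y t2 <= c + 0 * (t2 - t1) by rewrite mul0r addr0.
apply: (@threshold_growth _ E y) => //.
- by move=> r /andP[t1r _]; apply: yr; rewrite (le_trans t01).
- by move=> r /andP[t1r _]; apply: yl; rewrite (le_lt_trans t01).
move=> v /andP[t1v vt2] Ev cyv.
have t0v : t0 < v by rewrite (le_lt_trans t01).
have v0 : 0 <= v by rewrite ltW// (le_lt_trans t10).
have [d yd dN] := dy v t0v Ev.
exists d => //.
have [H|/existsNP[r /not_implyP[vrv /negP]]] :=
    pselect (forall r, v - tau v <= r <= v -> 0 <= y r).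
  have := dN 0 (lexx _); rewrite oppr0 mulr0 => /(_ H) dy0.
  rewrite (le_trans _ dy0)// lerDl mulr_ge0 ?a_ge0//.
  by rewrite (le_trans c0)// ltW.
rewrite -ltNge => yr0; exfalso.
suff : y v <= al * N by move=> /le_trans/(_ alc); rewrite leNgt cyv.
apply: (@delay_peak L al y S r v) => //.
- case/andP : vrv => + _; apply: le_trans; rewrite (le_trans St1)// tau_mono//.
  exact: ltW.
- by rewrite (le_trans Tt1)// ltW.
- by move=> w /andP[h1 h2]; apply: yN; rewrite h1 (le_trans h2).
- exact: ltW.
Qed.

(** While y is near y ts >= 0 the lower bound holds by continuity, and then
    [delay_stays_below] yields the upper bound. *)
Lemma delay_trap_step L al y S t1 ts K m m' : admissible_gain L al ->
  delay_inequality L y -> continuous_from t0 y ->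
  t0 <= S -> S <= t1 - tau t1 -> T <= t1 -> t1 <= ts -> 0 < K ->
  0 < m' -> 1 <= m -> al * m' <= m ->
  (forall v, S - tau S <= v <= t1 -> `|y v| <= K) ->
  (forall v, S - tau S <= v <= ts -> - (m' * K) <= y v <= m * K) ->
  0 <= y ts ->
  \forall v \near ts^'+, - (m' * K) <= y v <= m * K.
Proof.
move=> adm dy cy t0S St1 Tt1 t1s K0 m'0 m1 almm yK ymK yts.
have S0 : 0 <= S by rewrite (le_trans t0_ge0).
have t10 : 0 <= t1 by rewrite (le_trans T_ge0).
have St1' : S <= t1 by rewrite (le_trans St1)// gerBl tau_ge0.
have tst0 : t0 <= ts by rewrite (le_trans t0S)// (le_trans St1').
have cyts := cy.1 _ tst0.
have lbts : - (m' * K) < y ts by rewrite (lt_le_trans _ yts)// oppr_lt0 mulr_gt0.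
pose proof (cvgr_gt _ cyts _ lbts) as nearts; case: nearts => d /= d0 dH.
have lb v : S - tau S <= v -> v < ts + d -> - (m' * K) <= y v.
  move=> Sv vts; have [vts'|tsv] := leP v ts.
    by have /andP[] : - (m' * K) <= y v <= m * K by apply: ymK; rewrite Sv.
  apply/ltW/dH => //=; rewrite distrC ger0_norm ?subr_ge0 ?ltW//.
  by rewrite ltrBlDl.
exists d => //= v /= vd tsv.
have {}vd : v < ts + d.
  by move: vd; rewrite distrC ger0_norm ?subr_ge0 ?ltW// ltrBlDl.
have SS : S - tau S <= v.
  by rewrite (le_trans _ (ltW tsv))// (le_trans _ t1s)// (le_trans _ St1')// gerBl tau_ge0.
rewrite lb//=.
apply: (@delay_stays_below L al y S t1 v (m' * K)) => //.
- by rewrite ltW// (le_lt_trans t1s).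
- by rewrite mulr_ge0// ltW.
- by move=> w /andP[Sw wv]; apply: lb => //; rewrite (le_lt_trans wv).
- by rewrite mulrA ler_wpM2r// ltW.
- apply: (@le_trans _ _ K); last by rewrite ler_peMl// ltW.
  apply: (le_trans (ler_norm _)); apply: yK; rewrite lexx andbT.
  by rewrite (le_trans _ St1')// gerBl tau_ge0.
Qed.

(** With m1 = max 1 al2 and m2 = max 1 al1 one has al2 * m2 <= m1 and
    al1 * m1 <= m2, so that - m2 * K <= y implies y <= m1 * K and conversely.  Both
    bounds still hold at the infimum of the times where one of them fails; the
    sign of y there decides which of the two implications carries them further. *)
Lemma delay_trap L1 L2 al1 al2 y S t1 K :
  admissible_gain L1 al1 -> admissible_gain L2 al2 -> al1 * al2 <= 1 ->
  delay_inequality L2 y -> delay_inequality L1 (fun s => - y s) ->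
  continuous_from t0 y ->
  t0 <= S -> S <= t1 - tau t1 -> T <= t1 -> 0 < K ->
  (forall v, S - tau S <= v <= t1 -> `|y v| <= K) ->
  forall v, S - tau S <= v -> `|y v| <= (Num.max 1 al1 + Num.max 1 al2) * K.
Proof.
move=> adm1 adm2 al12 dy2 dy1 cy t0S St1 Tt1 K0 yK.
have al10 := gain_ge0 adm1; have al20 := gain_ge0 adm2.
have cNy := continuous_fromN cy.
set m2 := Num.max 1 al1; set m1 := Num.max 1 al2.
have m11 : 1 <= m1 by rewrite le_max lexx.
have m21 : 1 <= m2 by rewrite le_max lexx.
have m10 : 0 < m1 by rewrite (lt_le_trans ltr01).
have m20 : 0 < m2 by rewrite (lt_le_trans ltr01).
have alm2 : al2 * m2 <= m1.
  rewrite /m2; have [_|_] := leP 1 al1; last by rewrite mulr1 le_max lexx orbT.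
  by rewrite mulrC (le_trans al12).
have alm1 : al1 * m1 <= m2.
  rewrite /m1; have [_|_] := leP 1 al2; last by rewrite mulr1 le_max lexx orbT.
  by rewrite (le_trans al12).
have S0 : 0 <= S by rewrite (le_trans t0_ge0).
have t10 : 0 <= t1 by rewrite (le_trans T_ge0).
have St1' : S <= t1 by rewrite (le_trans St1)// gerBl tau_ge0.
have SS : S - tau S <= S by rewrite gerBl tau_ge0.
suff H v : S - tau S <= v -> - (m2 * K) <= y v <= m1 * K.
  move=> v /H/andP[ymin ymax]; rewrite ler_norml; apply/andP; split.
    by rewrite (le_trans _ ymin)// lerN2 mulrDl lerDl mulr_ge0// ltW.
  by rewrite (le_trans ymax)// mulrDl lerDr mulr_ge0// ltW.
have yK' w : S - tau S <= w <= t1 -> - (m2 * K) <= y w <= m1 * K.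
  move=> /yK; rewrite ler_norml => /andP[h1 h2]; apply/andP; split.
    by rewrite (le_trans _ h1)// lerN2 ler_peMl// ltW.
  by rewrite (le_trans h2)// ler_peMl// ltW.
apply: contraPP => /negP bad Sv.
pose bads := [set w | t1 <= w /\ ~~ (- (m2 * K) <= y w <= m1 * K)].
have t1v : t1 <= v.
  by rewrite leNgt; apply/negP => vt1; apply: (negP bad); rewrite yK'// Sv ltW.
have badsv : bads v by split.
have ib : has_inf bads by split; [exists v|exists t1 => w []].
set ts := inf bads.
have t1ts : t1 <= ts by apply: lb_le_inf; [exists v|move=> w []].
have good w : S - tau S <= w -> w < ts -> - (m2 * K) <= y w <= m1 * K.
  move=> Sw wts; have [|t1w] := leP w t1; first by move=> wt1; rewrite yK'// Sw.
  apply/negPn/negP => badw; have : ts <= w.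
    by apply: ge_inf; [exists t1 => ? []|split=> //; exact: ltW].
  by rewrite leNgt wts.
have Sts : S - tau S <= ts by rewrite (le_trans SS)// (le_trans St1').
have goods : - (m2 * K) <= y ts <= m1 * K.
  move: t1ts; rewrite le_eqVlt => /predU1P[<-|t1ts].
    by rewrite yK'// lexx andbT (le_trans SS).
  have ycv : y s @[s --> ts^'-] --> y ts.
    by apply: cy.2; rewrite (le_lt_trans _ t1ts)// (le_trans t0S).
  have gnear : \forall w \near ts^'-, - (m2 * K) <= y w <= m1 * K.
    near=> w; apply: good; last by near: w; exact: (nbhs_left_lt ts).
    rewrite (le_trans SS)// (le_trans St1')//; near: w.
    exact: (nbhs_left_ge t1ts).
  apply/andP; split.
    apply: (closed_cvg (fun z => - (m2 * K) <= z) _ _ _ ycv) => //.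
    by apply: filterS gnear => w /andP[].
  apply: (closed_cvg (fun z => z <= m1 * K) _ _ _ ycv) => //.
  by apply: filterS gnear => w /andP[].
have good' w : S - tau S <= w <= ts -> - (m2 * K) <= y w <= m1 * K.
  move=> /andP[Sw]; rewrite le_eqVlt => /predU1P[->//|]; exact: good.
have [d /= d0 dH] : \forall w \near ts^'+, - (m2 * K) <= y w <= m1 * K.
  have [yts|yts] := leP 0 (y ts).
    exact: (@delay_trap_step L2 al2 y S t1 ts K m1 m2).
  have H : \forall w \near ts^'+, - (m1 * K) <= - y w <= m2 * K.
    apply: (@delay_trap_step L1 al1 _ S t1 ts K m2 m1) => //.
    - by move=> w; rewrite normrN; exact: yK.
    - by move=> w /good' /andP[h1 h2]; rewrite lerN2 h2 lerNl.
    - by rewrite oppr_ge0 ltW.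
  by apply: filterS H => w; rewrite lerN2 lerNl andbC.
have [r [t1r badr] rd] := inf_adherent d0 ib.
have tsr : ts <= r by apply: ge_inf => //; exists t1 => ? [].
move: badr; rewrite (_ : _ <= _ <= _)//.
move: tsr; rewrite le_eqVlt => /predU1P[<-//|tsr].
apply: dH => //=; rewrite distrC ger0_norm ?subr_ge0 ?ltW//.
by rewrite ltrBlDl.
Unshelve. all: by end_near. Qed.

(** Where y exceeds K >= 0 the damping term has the favourable sign, so y grows at
    a rate of at most Lb * V. *)
Lemma delay_growth_step L y (Lb s c K V : R) : delay_inequality L y ->
  continuous_from t0 y -> t0 <= s -> s <= c ->
  0 <= Lb -> (forall v, t0 < v <= c -> L v <= Lb) ->
  0 <= K -> 0 <= V -> (forall v, v <= c -> - V <= y v) -> y s <= K ->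
  y c <= K + Lb * V * (c - s).
Proof.
move=> dy [yr yl] t0s sc Lb0 LLb K0 V0 yV ysK.
apply: (@threshold_growth _ E y) => //.
- exact: mulr_ge0.
- by move=> r /andP[sr _]; apply: yr; rewrite (le_trans t0s).
- by move=> r /andP[sr _]; apply: yl; rewrite (le_lt_trans t0s).
move=> v /andP[sv vc] Ev Kv; have t0v : t0 < v by rewrite (le_lt_trans t0s).
have [d yd dN] := dy v t0v Ev; exists d => //.
have := dN V V0 (fun r h => yV r (le_trans (andP h).2 vc)).
have av : 0 <= a v * y v.
  by rewrite mulr_ge0 ?a_ge0// ?(ltW (le_lt_trans t0_ge0 t0v))// (le_trans K0)// ltW.
move=> H; have : d <= L v * V by rewrite (le_trans _ H)// lerDl.
by move=> /le_trans; apply; rewrite ler_wpM2r// LLb// t0v.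
Qed.

(** On a step h with Lb * h <= 1 / 2 the maximum V of the modulus satisfies
    V <= K + V / 2. *)
Lemma delay_doubling L1 L2 y (Lb t1 s K : R) :
  delay_inequality L2 y -> delay_inequality L1 (fun v => - y v) ->
  continuous_from t0 y -> t0 <= s -> 0 <= Lb ->
  (forall v, t0 < v <= t1 -> L1 v <= Lb /\ L2 v <= Lb) -> 0 <= K ->
  (forall v, v <= s -> `|y v| <= K) ->
  forall v, v <= t1 -> v <= s + (2 * (Lb + 1))^-1 -> `|y v| <= 2 * K.
Proof.
move=> dy2 dy1 cy t0s Lb0 LLb K0 yK v vt1 vsh.
set h := (2 * (Lb + 1))^-1 in vsh.
have h0 : 0 < h by rewrite invr_gt0 mulr_gt0// ltr_wpDl.
have [vs|sv] := leP v s.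
  by rewrite (le_trans (yK v vs))// ler_peMl// ler1n.
have cyn : {within `[s, v], continuous (fun w => `|y w|)}.
  apply: (@within_continuous_from _ _ t0) => //; case: cy => yr yl.
  by split=> w tw; apply: cvg_norm; [exact: yr|exact: yl].
have [c cI cmax] := EVT_max (ltW sv) cyn.
apply: (le_trans (cmax v _)); first by rewrite in_itv/= lexx ltW.
set V := `|y c|.
move: cI; rewrite in_itv/= => /andP[sc cv].
have [VK|KV] := leP V K; first by rewrite (le_trans VK)// ler_peMl// ler1n.
have yV w : w <= c -> `|y w| <= V.
  move=> wc; have [ws|sw] := leP w s; first by rewrite (le_trans (yK w ws))// ltW.
  by apply: cmax; rewrite in_itv/= (ltW sw) (le_trans wc).
have V0 : 0 <= V by rewrite normr_ge0.
have ys := yK s (lexx s).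
have VV : V <= K + Lb * V * (c - s).
  have [yc|yc] := leP 0 (y c).
    rewrite {1}/V ger0_norm//; apply: (@delay_growth_step L2) => //.
    - by move=> w /andP[tw wc]; apply: (LLb w _).2; rewrite tw (le_trans wc)// (le_trans cv).
    - by move=> w /yV; rewrite ler_norml => /andP[].
    - exact: le_trans (ler_norm _) ys.
  rewrite {1}/V ltr0_norm//; apply: (@delay_growth_step L1 (fun v => - y v)) => //.
  - exact: continuous_fromN.
  - by move=> w /andP[tw wc]; apply: (LLb w _).1; rewrite tw (le_trans wc)// (le_trans cv).
  - by move=> w /yV; rewrite ler_norml lerN2 => /andP[].
  - by rewrite (le_trans _ ys)// -normrN ler_norm.
have csh : c - s <= h by rewrite lerBlDl (le_trans cv).
have Lh : Lb * V * (c - s) <= V / 2.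
  apply: (@le_trans _ _ (Lb * V * h)); first by rewrite ler_wpM2l// mulr_ge0.
  have -> : 2^-1 = (Lb + 1) * h by rewrite /h; field; rewrite gt_eqF// ltr_wpDl.
  rewrite -subr_ge0; have -> : V * ((Lb + 1) * h) - Lb * V * h = V * h by ring.
  by rewrite mulr_ge0// ltW.
lra.
Qed.

(** The number of doublings depends on Lb and on the interval only; this gives the
    uniformity in y that stability requires. *)
Lemma delay_growth L1 L2 (Lb t1 : R) : 0 <= Lb ->
  (forall v, t0 < v <= t1 -> L1 v <= Lb /\ L2 v <= Lb) ->
  exists2 C, 1 <= C & forall y K,
    delay_inequality L2 y -> delay_inequality L1 (fun v => - y v) ->
    continuous_from t0 y -> 0 <= K -> (forall v, v <= t0 -> `|y v| <= K) ->
    forall v, v <= t1 -> `|y v| <= C * K.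
Proof.
move=> Lb0 LLb; set h := (2 * (Lb + 1))^-1.
have h0 : 0 < h by rewrite invr_gt0 mulr_gt0// ltr_wpDl.
pose n := (Num.trunc ((t1 - t0) / h)).+1.
exists (2 ^+ n); first by rewrite exprn_ege1// ler1n.
move=> y K dy2 dy1 cy K0 yK v vt1.
have step m : forall v, v <= t1 -> v <= t0 + m%:R * h -> `|y v| <= 2 ^+ m * K.
  elim: m => [|m IH] w wt1 wm.
    by rewrite expr0 mul1r yK// (le_trans wm)// mul0r addr0.
  have [t1m|t1m] := leP t1 (t0 + m%:R * h).
    rewrite (le_trans (IH w wt1 (le_trans wt1 t1m)))// ler_wpM2r//.
    by rewrite ler_weXn2l// ler1n.
  rewrite exprS -mulrA; apply: (@delay_doubling L1 L2 y Lb t1 (t0 + m%:R * h)) => //.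
  - by rewrite lerDl mulr_ge0// ltW.
  - by rewrite mulr_ge0// exprn_ge0.
  - by move=> u um; apply: IH => //; rewrite (le_trans um)// ltW.
  - by rewrite (le_trans wm)// -addrA lerD2l -natr1 mulrDl mul1r.
apply: step => //; rewrite (le_trans vt1)// -lerBlDl -ler_pdivrMr//.
by rewrite ltW// /n truncnS_gt.
Qed.

Lemma eventually_shift S0 : exists2 S1 : R, T <= S1 & forall t, S1 <= t -> S0 <= t - tau t.
Proof.
have /cvgryPge/(_ S0)[M [_ HM]] := tau_lim.
exists (Num.max T (M + 1)); first by rewrite le_max lexx.
move=> t; rewrite ge_max => /andP[_ Mt]; apply: HM.
by rewrite (lt_le_trans _ Mt)// ltrDl.
Qed.

(** [delay_stays_below] applies from any sufficiently late time at which y <= 0. *)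
Lemma delay_contract L al y N : admissible_gain L al ->
  delay_inequality L y -> continuous_from t0 y ->
  (forall t : R, exists2 s, t <= s & y s <= 0) -> 0 <= N ->
  (exists S, forall t, S <= t -> - N <= y t) ->
  exists S, forall t, S <= t -> y t <= al * N.
Proof.
move=> adm dy cy low N0 [S0 yN].
have [S1 TS1 HS1] := eventually_shift S0.
pose S := Num.max t0 S1.
have [S2 TS2 HS2] := eventually_shift S.
have [t1 St1 yt1] := low S2.
exists t1 => t t1t; apply: (@delay_stays_below L al y S t1 t N) => //.
- by rewrite le_max lexx.
- exact: HS2.
- exact: le_trans St1.
- move=> v /andP[Sv _]; apply: yN; apply: le_trans Sv; apply: HS1.
  by rewrite le_max lexx orbT.
- by rewrite (le_trans yt1)// mulr_ge0// (gain_ge0 adm).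
Qed.

(** Using [delay_contract] for y and then for - y multiplies an eventual lower
    bound of y by al1 * al2. *)
Lemma delay_oscillation_vanishes L1 L2 al1 al2 y K :
  admissible_gain L1 al1 -> admissible_gain L2 al2 -> al1 * al2 < 1 ->
  delay_inequality L2 y -> delay_inequality L1 (fun s => - y s) ->
  continuous_from t0 y ->
  (forall t : R, exists2 s, t <= s & y s <= 0) ->
  (forall t : R, exists2 s, t <= s & 0 <= y s) ->
  0 <= K -> (exists S, forall t, S <= t -> - K <= y t) ->
  y t @[t --> +oo] --> (0 : R).
Proof.
move=> adm1 adm2 al12 dy2 dy1 cy low high K0 yK.
have al10 := gain_ge0 adm1; have al20 := gain_ge0 adm2.
have q0 : 0 <= al1 * al2 by rewrite mulr_ge0.
have up N : 0 <= N -> (exists S, forall t, S <= t -> - N <= y t) ->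
    exists S, forall t, S <= t -> y t <= al2 * N.
  exact: (@delay_contract L2 al2 y N).
have down n : exists S, forall t, S <= t -> - ((al1 * al2) ^+ n * K) <= y t.
  elim: n => [|n [S HS]]; first by rewrite expr0 mul1r.
  have Nn0 : 0 <= (al1 * al2) ^+ n * K by rewrite mulr_ge0// exprn_ge0.
  have [S' HS'] := up _ Nn0 (ex_intro _ S HS).
  have [] := @delay_contract L1 al1 (fun s => - y s) (al2 * ((al1 * al2) ^+ n * K)) adm1 dy1
    (continuous_fromN cy).
  - by move=> t; have [s ts ys] := high t; exists s => //; rewrite oppr_le0.
  - by rewrite mulr_ge0.
  - by exists S' => t St; rewrite lerN2; exact: HS'.
  move=> S'' HS''; exists S'' => t St.
  by rewrite exprS lerNl -!mulrA; exact: HS''.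
have cvg0 C : (al1 * al2) ^+ n * C @[n --> \oo] --> (0:R).
  rewrite -[X in _ --> X](mul0r C); apply: cvgMl; apply: cvg_expr.
  by rewrite ger0_norm.
apply/cvgrPdist_le => e e0.
have [n Hn] : exists n, (al1 * al2) ^+ n * K <= e /\ al2 * ((al1 * al2) ^+ n * K) <= e.
  pose proof (cvgr_le _ (cvg0 K) _ e0) as H1.
  pose proof (cvgr_le _ (cvg0 (al2 * K)) _ e0) as H2.
  have [n [h1 h2]] := filter_ex (filterI H1 H2).
  by exists n; split=> //; rewrite mulrCA.
have [S HS] := down n.
have [|S' HS'] := up _ _ (ex_intro _ S HS); first by rewrite mulr_ge0// exprn_ge0.
near=> t; rewrite sub0r normrN ler_norml; apply/andP; split.
  apply: le_trans (HS t _); first by rewrite lerN2 Hn.1.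
  by near: t; exact: (nbhs_pinfty_ge (num_real S)).
apply: le_trans (HS' t _) Hn.2.
by near: t; exact: (nbhs_pinfty_ge (num_real S')).
Unshelve. all: by end_near. Qed.

End delay_inequality.

(** * Piecewise continuous histories *)

Section piecewise_continuity.
Context {R : realType}.
Implicit Types (g h x phi psi : R -> R) (al be : R).

Definition glue (m : R) g h : R -> R := fun s => if s <= m then g s else h s.

Lemma PC_on_restrict al be al' be' g : al <= al' -> be' <= be ->
  PC_on al be g -> PC_on al' be' g.
Proof.
move=> aa bb [[[D gD] gr gl] glc].
have sub : `[al', be'] `<=` `[al, be]%classic.
  by apply: subset_itv; rewrite bnd_simp.
split; first split.
- exists D => t tab tD; apply: cvg_trans (gD t _ tD).
    by apply: cvg_app; exact: within_subset.
  by apply: sub.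
- move=> t; rewrite in_itv/= => /andP[t1 t2]; apply: gr.
  by rewrite in_itv/= (le_trans aa)// (lt_le_trans t2).
- move=> t; rewrite in_itv/= => /andP[t1 t2]; apply: gl.
  by rewrite in_itv/= (le_lt_trans aa)// (le_trans t2).
- move=> t; rewrite in_itv/= => /andP[t1 t2]; apply: glc.
  by rewrite in_itv/= (le_lt_trans aa)// (le_trans t2).
Qed.

Lemma PC_on_point al g : PC_on al al g.
Proof.
split; first split.
- by exists [:: al] => t; rewrite in_itv/= -eq_le inE => /eqP ->; rewrite eqxx.
- by move=> t; rewrite in_itv/= => /andP[h1 h2]; have := le_lt_trans h1 h2; rewrite ltxx.
- by move=> t; rewrite in_itv/= => /andP[h1 h2]; have := lt_le_trans h1 h2; rewrite ltxx.
- by move=> t; rewrite in_itv/= => /andP[h1 h2]; have := lt_le_trans h1 h2; rewrite ltxx.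
Qed.

(** At m the left limit comes from g and the right limit from h; the value g m keeps
    the result left continuous. *)
Lemma PC_on_glue al m be g h : al <= m -> m <= be ->
  PC_on al m g -> PC_on m be h -> PC_on al be (glue m g h).
Proof.
move=> am mb [[[D1 gD] gr gl] glc] [[[D2 hD] hr hl] hlc].
have nr t : m <= t -> \forall s \near t^'+, h s = glue m g h s.
  move=> mt; apply: filterS (nbhs_right_gt t) => s ts.
  by rewrite /glue leNgt (le_lt_trans mt).
have nr' t : t < m -> \forall s \near t^'+, g s = glue m g h s.
  by move=> tm; apply: filterS (nbhs_right_le tm) => s ts; rewrite /glue ts.
have nl t : t <= m -> \forall s \near t^'-, g s = glue m g h s.
  move=> tm; apply: filterS (nbhs_left_le t) => s st.
  by rewrite /glue (le_trans st).
have nl' t : m < t -> \forall s \near t^'-, h s = glue m g h s.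
  by move=> mt; apply: filterS (nbhs_left_gt mt) => s ms; rewrite /glue leNgt ms.
split; first split.
- exists (m :: D1 ++ D2) => t; rewrite in_itv/= => /andP[at_ tb].
  rewrite inE mem_cat !negb_or => /and3P[tm tD1 tD2].
  have [{}tm|{}mt|tm'] := ltgtP t m; last by rewrite tm' eqxx in tm.
    have gt : glue m g h t = g t by rewrite /glue ltW.
    rewrite gt; have := gD t _ tD1; rewrite in_itv/= at_ (ltW tm) => /(_ isT) H.
    move=> U /H; rewrite /within/= => HU.
    have Hm : \forall s \near t, s < m by exact: lt_nbhsl.
    apply: filterS2 Hm HU => s sm HU sab.
    rewrite /= /glue (ltW sm); apply: HU => /=; move: sab; rewrite !in_itv/=.
    by move=> /andP[-> _]; rewrite ltW.
  have gt : glue m g h t = h t by rewrite /glue leNgt mt.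
  rewrite gt; have := hD t _ tD2; rewrite in_itv/= tb (ltW mt) => /(_ isT) H.
  move=> U /H; rewrite /within/= => HU.
  have Hm : \forall s \near t, m < s by exact: lt_nbhsr.
  apply: filterS2 Hm HU => s sm HU sab.
  rewrite /= /glue leNgt sm/=; apply: HU => /=; move: sab; rewrite !in_itv/=.
  by move=> /andP[_ ->]; rewrite ltW.
- move=> t; rewrite in_itv/= => /andP[at_ tb].
  have [mt|tm] := leP m t.
    have /cvg_ex[l hl'] : cvg (h s @[s --> t^'+]) by apply: hr; rewrite in_itv/= mt.
    by apply/cvg_ex; exists l; apply: cvg_near_eq hl' _; exact: nr.
  have /cvg_ex[l gl'] : cvg (g s @[s --> t^'+]) by apply: gr; rewrite in_itv/= at_.
  by apply/cvg_ex; exists l; apply: cvg_near_eq gl' _; exact: nr'.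
- move=> t; rewrite in_itv/= => /andP[at_ tb].
  have [tm|mt] := leP t m.
    have /cvg_ex[l gl'] : cvg (g s @[s --> t^'-]) by apply: gl; rewrite in_itv/= at_.
    by apply/cvg_ex; exists l; apply: cvg_near_eq gl' _; exact: nl.
  have /cvg_ex[l hl'] : cvg (h s @[s --> t^'-]) by apply: hl; rewrite in_itv/= mt.
  by apply/cvg_ex; exists l; apply: cvg_near_eq hl' _; exact: nl'.
- move=> t; rewrite in_itv/= => /andP[at_ tb]; rewrite {2}/glue.
  have [tm|mt] := leP t m.
    by apply: cvg_near_eq (glc t _) (nl _ tm); rewrite in_itv/= at_.
  by apply: cvg_near_eq (hlc t _) (nl' _ mt); rewrite in_itv/= mt.
Qed.

Lemma near_right_translate c t (P : R -> Prop) :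
  (\forall s \near (t + c)^'+, P s) -> \forall s \near t^'+, P (s + c).
Proof.
move=> [e /= e0 H]; exists e => //= s /= se ts.
by apply: H => /=; [rewrite opprD addrACA subrr addr0|rewrite ltrD2r].
Qed.

Lemma near_left_translate c t (P : R -> Prop) :
  (\forall s \near (t + c)^'-, P s) -> \forall s \near t^'-, P (s + c).
Proof.
move=> [e /= e0 H]; exists e => //= s /= se ts.
by apply: H => /=; [rewrite opprD addrACA subrr addr0|rewrite ltrD2r].
Qed.

Lemma PC_on_shift al be g (c : R) : PC_on (al + c) (be + c) g ->
  PC_on al be (fun s => g (s + c)).
Proof.
move=> [[[D gD] gr gl] glc]; split; first split.
- exists [seq d - c | d <- D] => t tab tD U /= Ug.
  have tcD : t + c \notin D.
    by apply: contra tD => tcD; apply/mapP; exists (t + c) => //; rewrite addrK.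
  have tcab : t + c \in `[al + c, be + c].
    by move: tab; rewrite !in_itv/= !lerD2r.
  have [e /= e0 H] := gD _ tcab tcD U Ug; exists e => //= s /= se sab.
  apply: H => /=; first by rewrite opprD addrACA subrr addr0.
  by move: sab; rewrite !in_itv/= !lerD2r.
- move=> t tab; have /cvg_ex[l gl'] : cvg (g s @[s --> (t + c)^'+]).
    by apply: gr; move: tab; rewrite !in_itv/= lerD2r ltrD2r.
  by apply/cvg_ex; exists l => U /gl'; exact: near_right_translate.
- move=> t tab; have /cvg_ex[l gl'] : cvg (g s @[s --> (t + c)^'-]).
    by apply: gl; move: tab; rewrite !in_itv/= lerD2r ltrD2r.
  by apply/cvg_ex; exists l => U /gl'; exact: near_left_translate.
- move=> t tab U /glc; rewrite in_itv/= lerD2r ltrD2r => /(_ tab).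
  exact: near_left_translate.
Qed.

Lemma PC_on_segment x (t al be : R) : PC_on (t + al) (t + be) x ->
  PC_on al be (segment x t).
Proof.
rewrite (addrC t al) (addrC t be) => /PC_on_shift.
by under eq_fun do rewrite addrC.
Qed.

Lemma BPC_glue m psi h (dl : R) : m <= 0 -> BPC psi -> PC_on m 0 h ->
  (forall s, m <= s <= 0 -> `|psi s - h s| <= dl) -> BPC (glue m psi h).
Proof.
move=> m0 [psicl [M psiM]] ph hdl; split.
  move=> al be albe be0 e e0; set al' := Num.min al m.
  have [|h1 ph1 h1e] := psicl al' m _ m0 e e0; first by rewrite ge_min lexx orbT.
  exists (glue m h1 h).
    apply: (@PC_on_restrict al' 0) => //; first by rewrite ge_min lexx.
    by apply: PC_on_glue => //; rewrite ge_min lexx orbT.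
  move=> s; rewrite in_itv/= => /andP[als sbe]; rewrite /glue.
  have [sm|ms] := leP s m; last by rewrite subrr normr0 ltW.
  by apply: h1e; rewrite in_itv/= sm andbT ge_min als.
exists (M + dl) => s s0; rewrite /glue; have [sm|ms] := leP s m.
  rewrite (le_trans (psiM s s0))// lerDl.
  by apply: le_trans (hdl m _) => //; rewrite lexx.
rewrite -[h s](subrKC (psi s)) (le_trans (ler_normD _ _))// lerD//; first exact: psiM.
by rewrite distrC; apply: hdl; rewrite s0 ltW.
Qed.

(** The part of the segment before t0 is a uniform limit of piecewise continuous
    functions, the part after t0 is piecewise continuous: an approximation of the
    former is glued to the latter. *)
Lemma BPC_segment phi x (t0 t : R) : BPC phi -> (forall s, s <= 0 -> x (t0 + s) = phi s) ->
  t0 <= t -> PC_on t0 t x -> (exists M, forall s, t0 <= s <= t -> `|x s| <= M) ->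
  BPC (segment x t).
Proof.
move=> [phicl [M phiM]] xphi t0t xPC [M' xM']; split.
  move=> al be albe be0 e e0.
  pose al1 := Num.min (t + al - t0) 0.
  have [|h ph he] := phicl al1 0 _ (lexx _) e e0; first by rewrite ge_min lexx orbT.
  exists (segment (glue t0 (fun s => h (s - t0)) x) t).
    apply: PC_on_segment; apply: (@PC_on_restrict (t0 + al1) t).
    - by rewrite -lerBrDl ge_min lexx.
    - by rewrite gerDl.
    - apply: PC_on_glue => //; first by rewrite gerDl ge_min lexx orbT.
      by apply: PC_on_shift; rewrite subrr addrAC subrr add0r.
  move=> s; rewrite in_itv/= => /andP[als sbe]; rewrite /segment /glue.
  have [st0|t0s] := leP (t + s) t0; last by rewrite subrr normr0 ltW.
  have -> : t + s = t0 + (t + s - t0) by rewrite subrKC.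
  rewrite xphi ?subr_le0// subrKC; apply: he.
  rewrite in_itv/= subr_le0 st0 andbT ge_min; apply/orP; left.
  by rewrite lerB// lerD2l.
exists (Num.max M M') => s s0; rewrite /segment le_max.
have [st0|t0s] := leP (t + s) t0.
  by rewrite -[t + s](subrKC t0) xphi ?subr_le0// phiM// subr_le0.
by apply/orP; right; apply: xM'; rewrite (ltW t0s) gerDl.
Qed.

Lemma Mfun_le (tau : R -> R) (t N : R) phi : 0 <= tau t -> 0 <= N ->
  (forall th, - tau t <= th <= 0 -> phi th <= N) -> Mfun tau t phi <= N.
Proof.
move=> tau0 N0 phiN; rewrite /Mfun ge_max N0/=; apply: ge_sup.
  by exists (phi 0); exists 0 => //=; rewrite in_itv/= lexx oppr_le0 tau0.
by move=> _ [th + <-]; rewrite /= in_itv/= => thI; exact: phiN.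
Qed.

(** The bounds on f concern piecewise continuous histories, whereas histories that
    reach back to the initial function are uniform limits of such functions.  The
    approximation phi equals psi up to and including the left endpoint of the
    window, so that it remains left continuous there as an element of BPC; on the
    window itself only a right limit is required at that point. *)
Lemma BPC_PC_approx (tau : R -> R) (f : R -> (R -> R) -> R) (t e dl : R) psi :
  0 <= t -> 0 <= tau t ->
  (forall e, 0 < e -> exists2 d : R, 0 < d &
    forall s phi, 0 <= s -> `|s - t| < d -> BPC phi ->
      bpc_norm (fun th => phi th - psi th) < d -> `|f s phi - f t psi| < e) ->
  BPC psi -> 0 < e -> 0 < dl ->
  exists phi, [/\ PC_at tau t phi,
    forall th, - tau t <= th <= 0 -> `|psi th - phi th| <= dl &
    `|f t phi - f t psi| < e].
Proof.
move=> t_ge0 tau_ge0 fc bpsi e0 dl0; have [d d0 fd] := fc e e0.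
have ntau0 : - tau t <= 0 by rewrite oppr_le0.
pose e1 := Num.min (d / 2) dl.
have e10 : 0 < e1 by rewrite lt_min divr_gt0.
have [h ph he] := bpsi.1 (- tau t) 0 ntau0 (lexx _) e1 e10.
have hb : BPC (glue (- tau t) psi h).
  by apply: (@BPC_glue _ _ _ e1) => // s sI; apply: he; rewrite in_itv.
have gle th : th <= 0 -> `|psi th - glue (- tau t) psi h th| <= e1.
  move=> th0; rewrite /glue; have [_|th1] := leP th (- tau t).
    by rewrite subrr normr0 ltW.
  by apply: he; rewrite in_itv/= th0 ltW.
exists (glue (- tau t) psi h); split.
- exact: PC_on_glue (PC_on_point _ _) ph.
- by move=> th /andP[_ th0]; rewrite (le_trans (gle _ th0))// ge_min lexx orbT.
- apply: fd => //; first by rewrite subrr normr0.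
  apply: (@le_lt_trans _ _ e1); last first.
    by rewrite gt_min ltr_pdivrMr// ltr_pMr// ltr1n.
  apply: ge_sup; first by exists `|glue (- tau t) psi h 0 - psi 0|; exists 0 => //=; rewrite in_itv/=.
  by move=> _ [th + <-]; rewrite /= in_itv/= => th0; rewrite distrC gle.
Qed.

End piecewise_continuity.

(** * Piecewise continuous coefficients *)

Section piecewise_continuous_coefficients.
Context {R : realType}.
Notation mu := (@lebesgue_measure R).

Lemma PC_nneg_continuous (g : R -> R) : piecewise_continuous_nneg g ->
  exists2 E : set R, countable E &
    forall t, 0 < t -> ~ E t -> {for t, continuous g}.
Proof.
move=> gpc; have /choice[D DP] (n : nat) : exists D : seq R,
    forall t, t \in `[0, n%:R] -> t \notin D ->
      g s @[s --> within `[0, n%:R] (nbhs t)] --> g t.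
  by have [] := gpc n%:R (ler0n _ _).
exists (\bigcup_n [set` D n]).
  apply: bigcup_countable => // n _; apply: finite_set_countable.
  exact: finite_seq.
move=> t t0 tD; pose n := (Num.trunc t).+1.
have tn : t < n%:R by rewrite /n -truncn_le_nat // ?ltnn; exact: ltW.
have /(DP n t) H : t \in `[0, n%:R] by rewrite in_itv/= !ltW.
move=> U /H; rewrite /within/= => HU.
have {}HU : \forall s \near t, s \in `[0, n%:R] -> U (g s).
  by apply: HU; apply/negP => tDn; apply: tD; exists n.
have Hm : \forall s \near t, 0 < s by exact: lt_nbhsr.
have Hn : \forall s \near t, s < n%:R by exact: lt_nbhsl.
apply: filterS3 Hm Hn HU => s s0 sn; apply.
by rewrite in_itv/= !ltW.
Qed.

(** One-sided limits bound g near each point, and the interval is compact. *)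
Lemma PC_bounded (g : R -> R) (al b : R) : piecewise_continuous_on al b g ->
  exists M, forall t, al <= t <= b -> `|g t| <= M.
Proof.
move=> [_ gr gl].
have H : \forall M \near +oo, `[al, b]%classic `<=` (fun t => `|g t| <= M).
  have /compact_near_coveringP/near_covering_withinP := @segment_compact R al b.
  apply => t /=; rewrite in_itv/= => /andP[t0 tb].
  have one_side (F : set_system R) : Filter F -> cvg (g s @[s --> F]) ->
      exists M, \forall s \near F, `|g s| <= M.
    move=> FF /cvg_ex[l gl']; exists (`|l| + 1).
    pose proof (cvgr_dist_le _ _ gl' _ ltr01) as H; apply: filterS H => s H.
    rewrite -[g s](subrKC l) (le_trans (ler_normD _ _))// lerD2l.
    by rewrite distrC.
  have [M1 HM1] : exists M, \forall s \near t^'-, al <= s -> `|g s| <= M.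
    move: t0; rewrite le_eqVlt => /predU1P[<-|t0].
      exists 0; apply: filterS (nbhs_left_lt al) => s s0.
      by rewrite leNgt s0.
    have [|M HM] := one_side (t^'-) _; first by apply: gl; rewrite in_itv/= t0.
    by exists M; apply: filterS HM.
  have [M2 HM2] : exists M, \forall s \near t^'+, s <= b -> `|g s| <= M.
    move: tb; rewrite le_eqVlt => /predU1P[->|tb].
      exists 0; apply: filterS (nbhs_right_gt b) => s s0.
      by rewrite leNgt s0.
    have [|M HM] := one_side (t^'+) _; first by apply: gr; rewrite in_itv/= t0.
    by exists M; apply: filterS HM.
  have Hs : \forall s \near t, al <= s <= b -> `|g s| <= Num.max M1 (Num.max M2 `|g t|).
    move: HM1 HM2 => [d1 /= d10 H1] [d2 /= d20 H2].
    exists (Num.min d1 d2); first by rewrite /= lt_min d10.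
    move=> s /=; rewrite lt_min => /andP[sd1 sd2] /andP[s0 sb].
    rewrite !le_max; have [st|ts|->] := ltgtP s t; last by rewrite lexx !orbT.
      by rewrite H1.
    by rewrite H2// orbT.
  pose m := Num.max M1 (Num.max M2 `|g t|).
  exists ([set s | al <= s <= b -> `|g s| <= m], [set M | m <= M]).
    by split => //=; exact: (nbhs_pinfty_ge (num_real m)).
  by move=> [s M] /= [sm mM] sab; apply: le_trans mM; apply: sm; move: sab; rewrite in_itv.
have [M HM] := filter_ex H; exists M => t tb; apply: HM.
by rewrite /= in_itv.
Qed.

Lemma PC_measurable (g : R -> R) (b : R) : piecewise_continuous_on 0 b g ->
  measurable_fun `[0, b] g.
Proof.
move=> [[D gD] _ _].
have fD : countable [set` D] by apply: finite_set_countable; exact: finite_seq.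
have mD : measurable [set` D] by apply: countable_measurable.
rewrite -(setUIDK `[0, b]%classic [set` D]); apply/measurable_funU.
- exact: measurableI.
- exact: measurableD.
split.
  move=> _ Y mY; apply: countable_measurable => //.
  by apply: sub_countable fD; apply: subset_card_le => x [[]].
apply: subspace_continuous_measurable_fun; first exact: measurableD.
apply/subspace_continuousP => x [xab xD].
apply: cvg_trans (gD x xab _); last exact/negP.
by apply: cvg_app; apply: within_subset => y [].
Qed.

End piecewise_continuous_coefficients.

(** * Counting impulses *)

Section impulse_times.
Context {R : realType}.
Notation mu := (@lebesgue_measure R).
Variable tk : nat -> R.
Hypothesis tk_incr : forall k, tk k < tk k.+1.
Hypothesis tk_lim : tk k @[k --> \oo] --> +oo.
Implicit Types (t s : R) (c : nat -> R).

Lemma tk_lt m n : (m < n)%N -> tk m < tk n.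
Proof.
apply: (@homo_ltn _ tk (fun x y => x < y)) => // y x z; exact: lt_trans.
Qed.

Lemma tk_le m n : (m <= n)%N -> tk m <= tk n.
Proof. by rewrite leq_eqVlt => /predU1P[->//|/tk_lt/ltW]. Qed.

Lemma tk_unbounded t : exists n, t <= tk n.
Proof. by have /cvgryPge/(_ t)/filter_ex := tk_lim. Qed.

(** Only impulses strictly before t are counted, so that products over them are left
    continuous like the solutions. *)
Definition impulse_count t : nat := ex_minn (tk_unbounded t).
Local Notation cnt := impulse_count.

Lemma impulse_countP t k : (k < cnt t)%N = (tk k < t).
Proof.
rewrite /cnt; case: ex_minnP => m tm mmin; apply/idP/idP => [km|tkt].
  by rewrite ltNge; apply: contraL km => /mmin; rewrite -leqNgt.
by rewrite ltnNge; apply: contraL tkt => /tk_le; rewrite -leNgt; exact: le_trans.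
Qed.

Lemma impulse_count_leP t k : (cnt t <= k)%N = (t <= tk k).
Proof. by rewrite leqNgt impulse_countP -leNgt. Qed.

Lemma impulse_count_le s t : s <= t -> (cnt s <= cnt t)%N.
Proof. by move=> st; rewrite impulse_count_leP (le_trans st)// -impulse_count_leP. Qed.

Lemma impulse_count_tk k : cnt (tk k) = k.
Proof.
apply/eqP; rewrite eqn_leq impulse_count_leP lexx/=; case: k => [//|k].
by rewrite impulse_countP.
Qed.

Lemma impulse_count_ge_near t : \forall s \near t, (cnt t <= cnt s)%N.
Proof.
case e : (cnt t) => [|n]; first by exists 1 => //=.
have tnt : tk n < t by rewrite -impulse_countP e.
by have := lt_nbhsr tnt; apply: filterS => s; rewrite impulse_countP.
Qed.

Lemma impulse_count_left t : \forall s \near t^'-, cnt s = cnt t.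
Proof.
have H : \forall s \near t^'-, (cnt t <= cnt s)%N.
  by apply: cvg_within; exact: impulse_count_ge_near.
have st : \forall s \near t^'-, s < t by exact: nbhs_left_lt.
apply: filterS2 st H => s st H; apply/eqP.
by rewrite eqn_leq H impulse_count_le// ltW.
Qed.

Lemma impulse_count_right t : (forall k, t != tk k) ->
  \forall s \near t^'+, cnt s = cnt t.
Proof.
move=> ttk; have tlt : t < tk (cnt t).
  by rewrite lt_neqAle ttk/= -impulse_count_leP.
apply: filterS2 (nbhs_right_gt t) (nbhs_right_le tlt) => s ts stk.
by apply/eqP; rewrite eqn_leq impulse_count_leP stk impulse_count_le// ltW.
Qed.

Lemma impulse_count_right_tk k : \forall s \near (tk k)^'+, cnt s = k.+1.
Proof.
apply: filterS2 (nbhs_right_gt (tk k)) (nbhs_right_le (tk_incr k)) => s ks sk.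
by apply/eqP; rewrite eqn_leq impulse_count_leP sk impulse_countP.
Qed.

End impulse_times.

(** * Products over impulses *)

Section impulse_products.
Context {R : realType}.
Notation mu := (@lebesgue_measure R).
Variable tk : nat -> R.
Hypothesis tk_incr : forall k, tk k < tk k.+1.
Hypothesis tk_lim : tk k @[k --> \oo] --> +oo.
Implicit Types (t s : R) (c : nat -> R).
Local Notation cnt := (impulse_count tk_lim).

Definition impulse_product c t := \prod_(0 <= k < cnt t) c k.
Local Notation Q := impulse_product.

Lemma impulse_product_gt0 c t : (forall k, 0 < c k) -> 0 < Q c t.
Proof. by move=> c0; apply: prodr_gt0. Qed.

Lemma impulse_product_left c t : \forall s \near t^'-, Q c s = Q c t.
Proof. by apply: filterS (impulse_count_left tk_incr tk_lim t) => s; rewrite /Q => ->. Qed.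

Lemma impulse_product_right c t : (forall k, t != tk k) ->
  \forall s \near t^'+, Q c s = Q c t.
Proof.
move=> ttk; apply: filterS (impulse_count_right tk_incr tk_lim ttk) => s.
by rewrite /Q => ->.
Qed.

Lemma impulse_product_right_tk c k :
  \forall s \near (tk k)^'+, Q c s = Q c (tk k) * c k.
Proof.
apply: filterS (impulse_count_right_tk tk_incr tk_lim k) => s.
by rewrite /Q => ->; rewrite big_nat_recr//= impulse_count_tk.
Qed.

Lemma impulse_product_split c s t : s <= t ->
  Q c t = Q c s * \prod_(cnt s <= k < cnt t) c k.
Proof.
by move=> st; rewrite /Q (big_cat_nat (n := cnt s))//= impulse_count_le.
Qed.

Variable bk : nat -> R.
Hypothesis bk_gt0 : forall k, 0 < bk k.

(** Each factor is at least 1 and at least (bk k)^-1, so this dominates the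
    products of (bk k)^-1 over all subintervals of the first n indices. *)
Definition inverse_bound n := \prod_(0 <= k < n) (1 + (bk k)^-1).
Local Notation W := inverse_bound.

Lemma inverse_prod_le j n N : (j <= n <= N)%N ->
  \prod_(j <= k < n) (bk k)^-1 <= W N.
Proof.
move=> /andP[jn nN].
have ge1 m p : 1 <= \prod_(m <= k < p) (1 + (bk k)^-1).
  apply: (big_ind (fun x : R => 1 <= x)) => //; first exact: mulr_ege1.
  by move=> i _; rewrite lerDl invr_ge0 ltW.
have ge0 m p : 0 <= \prod_(m <= k < p) (1 + (bk k)^-1) by rewrite (le_trans ler01).
apply: (@le_trans _ _ (\prod_(j <= k < n) (1 + (bk k)^-1))).
  by apply: ler_prod => i _; rewrite invr_ge0 ltW//= lerDr.
rewrite /W (big_cat_nat (m := 0) (n := j))//= ?(leq_trans jn)//.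
rewrite (big_cat_nat (n := n) (m := j) (p := N))//= mulrCA ler_peMr//.
exact: mulr_ege1.
Qed.

Lemma inverse_bound_ge1 n : 1 <= W n.
Proof.
by have := @inverse_prod_le 0 0 n isT; rewrite big_geq.
Qed.

Definition window_sup m n :=
  sup [set \prod_(j <= k < n) (bk k)^-1 | j in [set j | m <= j <= n]%N].

Let window_ub m n : has_ubound
  [set \prod_(j <= k < n) (bk k)^-1 | j in [set j | m <= j <= n]%N].
Proof.
by exists (W n) => _ [j /= /andP[_ jn] <-]; apply: inverse_prod_le; rewrite jn leqnn.
Qed.

Lemma window_sup_ub j m n : (m <= j <= n)%N ->
  \prod_(j <= k < n) (bk k)^-1 <= window_sup m n.
Proof. by move=> mjn; apply: ub_le_sup => //; exists j. Qed.

Lemma window_sup_le m n N : (m <= n <= N)%N -> window_sup m n <= W N.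
Proof.
move=> /andP[mn nN]; apply: ge_sup; first by exists (\prod_(m <= k < n) (bk k)^-1), m => //=; rewrite leqnn.
by move=> _ [j /= /andP[_ jn] <-]; apply: inverse_prod_le; rewrite jn.
Qed.

Variable tau : R -> R.
Hypothesis tau_ge0 : forall t, 0 <= t -> 0 <= tau t.
Hypothesis tau_cont : {within `[0, +oo[, continuous tau}.
Hypothesis tau_mono : forall s t : R, 0 <= s -> s <= t -> s - tau s <= t - tau t.

Local Notation B := (Bfun tau tk bk).

(** While t + th runs through the window, its impulse count takes every value
    between those of t - tau t and t; so B t depends on these two counts only. *)
Lemma BfunE t : 0 <= t -> B t = window_sup (cnt (t - tau t)) (cnt t).
Proof.
move=> t0; have prodE th : \big[*%R/1]_(k \in [set k | t + th <= tk k < t]) (bk k)^-1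
    = \prod_(cnt (t + th) <= k < cnt t) (bk k)^-1.
  have -> : [set k | t + th <= tk k < t] =
      [set` index_iota (cnt (t + th)) (cnt t)].
    apply/seteqP; split=> k /=;
      by rewrite mem_index_iota impulse_countP// impulse_count_leP.
  by rewrite -fsbig_seq// iota_uniq.
rewrite /Bfun /window_sup; congr sup; apply/seteqP; split=> [_ [th + <-]|_ [j + <-]]/=.
  rewrite /= in_itv/= prodE => /andP[th1 th0].
  exists (cnt (t + th)) => //=; rewrite !impulse_count_le//.
    by rewrite gerDl.
  by rewrite lerD2l.
move=> /andP[j1 j2]; have [jt|jt] := ltnP j (cnt t); last first.
  have -> : j = cnt t by apply/eqP; rewrite eqn_leq j2.
  by exists 0; rewrite ?prodE ?addr0//= in_itv/= lexx oppr_le0 tau_ge0.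
exists (tk j - t); last by rewrite prodE subrKC impulse_count_tk.
move: j1 jt; rewrite impulse_count_leP// impulse_countP// in_itv/= => j1 j3.
by rewrite subr_le0 (ltW j3) andbT lerBrDl.
Qed.

Lemma Bfun_ub t r : 0 <= t -> t - tau t <= r <= t ->
  \prod_(cnt r <= k < cnt t) (bk k)^-1 <= B t.
Proof.
move=> t0 /andP[tr rt]; rewrite BfunE//; apply: window_sup_ub.
by rewrite !impulse_count_le.
Qed.

Lemma Bfun_ge1 t : 0 <= t -> 1 <= B t.
Proof.
move=> t0; have := @Bfun_ub t t t0; rewrite big_geq//; apply.
by rewrite lexx gerBl tau_ge0.
Qed.

Lemma Bfun_le t b : 0 <= t <= b -> B t <= W (cnt b).
Proof.
move=> /andP[t0 tb]; rewrite BfunE//; apply: window_sup_le.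
by rewrite !impulse_count_le// gerBl tau_ge0.
Qed.

Lemma Bfun_measurable (b : R) : measurable_fun `[0, b] B.
Proof.
apply: (@eq_measurable_fun _ _ _ _ _ (fun t => window_sup (cnt (t - tau t)) (cnt t))).
  by move=> t; rewrite inE/= in_itv/= => /andP[t0 _]; rewrite BfunE.
move=> _ Y mY.
pose F i j := `[0, b] `&` [set t | cnt (t - tau t) = i] `&` [set t | cnt t = j].
have mF i j : measurable (F i j).
  apply: is_interval_measurable => x y; rewrite /F/= !in_itv/=.
  move=> [[/andP[x0 xb] xi] xj] [[/andP[y0 yb] yi] yj] z /andP[xz zy].
  split; first split.
  - by rewrite /= in_itv/= (le_trans x0)// (le_trans zy).
  - apply/eqP; rewrite eqn_leq -{1}yi -xi !impulse_count_le// tau_mono//.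
    exact: le_trans xz.
  - by apply/eqP; rewrite eqn_leq -{1}yj -xj !impulse_count_le.
rewrite (_ : _ `&` _ = \bigcup_i \bigcup_j (if pselect (Y (window_sup i j)) then F i j else set0)).
  apply: bigcupT_measurable => i; apply: bigcupT_measurable => j.
  by case: pselect => ?; [exact: mF|exact: measurable0].
apply/seteqP; split=> [t /= [tb Yt]|t [i _] [j _]].
  exists (cnt (t - tau t)) => //; exists (cnt t) => //.
  by case: pselect.
by case: pselect => //= Y' [[tb ti] tj]; split=> //; rewrite /= ti tj.
Qed.

(** By [BfunE], B is locally constant where the counts of t and of t - tau t are.
    The second one jumps at t only if t is the last time at which t - tau t equals
    some tk k, and there is at most one such t for each k. *)
Lemma Bfun_continuous : exists2 E : set R, countable E &
  forall t, 0 < t -> ~ E t -> {for t, continuous B}.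
Proof.
pose J k := [set t | [/\ 0 < t, t - tau t = tk k & forall s, t < s -> tk k < s - tau s]].
exists (range tk `|` \bigcup_k J k).
  apply: countable_setU.
    by apply: (sub_countable (card_image_le _ _)); exact: countableP.
  apply: bigcup_countable => // k _; apply: finite_set_countable.
  have [[t Jt]|H] := pselect (exists t, J k t).
    apply: (@sub_finite_set _ _ [set t]); last exact: finite_set1.
    move=> s [s0 sk sH] /=; case: Jt => t0' tk' tH.
    have [st|ts|//] := ltgtP s t.
      by have := sH _ st; rewrite tk' ltxx.
    by have := tH _ ts; rewrite sk ltxx.
  apply: (@sub_finite_set _ _ set0) => // t Jt; apply: H; by exists t.
move=> t t0 /not_orP[ttk tJ].
have ctau : s - tau s @[s --> t] --> t - tau t.
  apply: cvgB; first exact: cvg_id.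
  have /continuous_within_itvcyP[+ _] := tau_cont.
  by apply; rewrite in_itv/= t0.
have cnt_near u : \forall v \near u, (cnt u <= cnt v)%N.
  exact: impulse_count_ge_near.
have c1 : \forall s \near t, cnt s = cnt t.
  have tlt : t < tk (cnt t).
    rewrite lt_neqAle -impulse_count_leP// leqnn andbT; apply/eqP => tE.
    by apply: ttk; exists (cnt t).
  apply: filterS2 (cnt_near t) (lt_nbhsl tlt) => s H1 H2.
  by apply/eqP; rewrite eqn_leq H1 impulse_count_leP// ltW.
have c2 : \forall s \near t, (cnt (t - tau t) <= cnt (s - tau s))%N.
  exact: (ctau _ (cnt_near (t - tau t))).
have c3 : \forall s \near t, 0 < s -> (cnt (s - tau s) <= cnt (t - tau t))%N.
  set k := cnt (t - tau t).
  have : t - tau t <= tk k by rewrite -impulse_count_leP.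
  rewrite le_eqVlt => /predU1P[tE|tlt]; last first.
    pose proof (cvgr_lt _ ctau _ tlt) as H.
    by apply: filterS H => s st _; rewrite impulse_count_leP// ltW.
  have [s1 ts1 s1k] : exists2 s1, t < s1 & s1 - tau s1 <= tk k.
    apply: contrapT => H; apply: tJ; exists k => //; split => // s ts.
    by rewrite ltNge; apply/negP => sk; apply: H; exists s.
  apply: filterS (lt_nbhsl ts1) => s ss1 s0; rewrite impulse_count_leP//.
  by rewrite (le_trans _ s1k)// tau_mono// ltW.
have HB : \forall s \near t, B t = B s.
  apply: filterS3 (filterI c1 c2) c3 (lt_nbhsr t0) => s [h1 h2] h3 s0.
  rewrite !BfunE ?ltW// h1; congr window_sup; apply/eqP.
  by rewrite eqn_leq h2 h3.
move=> U BU; apply: filterS HB => s /= <-; exact: nbhs_singleton.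
Qed.

End impulse_products.

(** * Gains *)

Section gains.
Context {R : realType}.
Notation mu := (@lebesgue_measure R).
Variables (tau a : R -> R) (tk bk : nat -> R) (T : R).
Hypothesis tau_ge0 : forall t : R, 0 <= t -> 0 <= tau t.
Hypothesis tau_cont : {within `[0, +oo[, continuous tau}.
Hypothesis tau_mono : forall s t : R, 0 <= s -> s <= t -> s - tau s <= t - tau t.
Hypothesis tk_incr : forall k, tk k < tk k.+1.
Hypothesis tk_lim : tk k @[k --> \oo] --> +oo.
Hypothesis bk_gt0 : forall k, 0 < bk k.
Local Notation B := (Bfun tau tk bk).

(** The set E' is free so that one exceptional set can be used for both gains. *)
Lemma gain_alpha (lam : R -> R) :
  (forall t, 0 <= t -> 0 <= lam t) -> piecewise_continuous_nneg lam ->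
  alpha tau a tk bk T lam \is a fin_num ->
  exists2 E : set R, countable E &
    forall E' : set R, E `<=` E' ->
      admissible_gain tau a T E' (fun s => lam s * B s)
        (fine (alpha tau a tk bk T lam)).
Proof.
move=> lam0 lamPC afin.
have [E1 cE1 E1c] := PC_nneg_continuous lamPC.
have [E2 cE2 E2c] := Bfun_continuous tk_incr tk_lim bk tau_ge0 tau_cont tau_mono.
exists (E1 `|` E2); first exact: countable_setU.
move=> E' EE'; split.
- move=> t t0; rewrite mulr_ge0// ?lam0// (le_trans ler01)//.
  exact: (Bfun_ge1 tk_incr tk_lim bk_gt0 tau_ge0).
- move=> t t0 Et; apply: cvgM; [apply: E1c => // ?|apply: E2c => // ?].
    by apply: Et; apply: EE'; left.
  by apply: Et; apply: EE'; right.
- move=> b; apply: measurable_funM; last exact: (Bfun_measurable tk_incr tk_lim bk tau_ge0 tau_mono).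
  have [b0|b0] := leP 0 b; first by apply: PC_measurable; exact: lamPC.
  by rewrite set_itv_ge ?bnd_simp -?ltNge//; exact: measurable_fun_set0.
- move=> t Tt; rewrite fineK//; apply: ereal_sup_ubound => /=.
  exists t => /=; first by rewrite in_itv/= Tt.
  by apply: eq_integral => s _; rewrite mulrAC.
Qed.

Lemma gain_bounded (lam : R -> R) (b : R) : piecewise_continuous_nneg lam ->
  0 <= b -> exists M, forall t, 0 <= t <= b -> lam t * B t <= M.
Proof.
move=> lamPC b0; have [M HM] := PC_bounded (lamPC b b0).
exists (M * inverse_bound bk (impulse_count tk_lim b)) => t tb.
have M0 : 0 <= M by rewrite (le_trans _ (HM t tb)).
apply: (@le_trans _ _ (M * B t)).
  apply: ler_wpM2r; last exact: le_trans (ler_norm _) (HM t tb).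
  rewrite (le_trans ler01)// (Bfun_ge1 tk_incr tk_lim bk_gt0 tau_ge0)//.
  by case/andP : tb.
by rewrite ler_wpM2l// (Bfun_le tk_incr tk_lim bk_gt0 tau_ge0).
Qed.

End gains.

(** * The feedback along a history *)

Section history_bounds.
Context {R : realType}.
Variables (tau : R -> R) (f : R -> (R -> R) -> R) (lam1 lam2 : R -> R).
Hypothesis tau_ge0 : forall t : R, 0 <= t -> 0 <= tau t.
Hypothesis lam_ge0 : forall t : R, 0 <= t -> 0 <= lam1 t /\ 0 <= lam2 t.
Hypothesis f_bound : forall t phi, 0 <= t -> PC_at tau t phi ->
  - lam1 t * Mfun tau t phi <= f t phi <= lam2 t * Mfun tau t (fun th => - phi th).

Lemma PC_history_bounds t phi N : 0 <= t -> PC_at tau t phi -> 0 <= N ->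
  ((forall th, - tau t <= th <= 0 -> - N <= phi th) -> f t phi <= lam2 t * N) /\
  ((forall th, - tau t <= th <= 0 -> phi th <= N) -> - (lam1 t * N) <= f t phi).
Proof.
move=> t0 ph N0; have /andP[f1 f2] := f_bound t0 ph.
have [l1 l2] := lam_ge0 t0.
split=> H.
  apply: (le_trans f2); rewrite ler_wpM2l// Mfun_le ?tau_ge0// => th /H.
  by rewrite lerNl.
apply: le_trans f1; rewrite mulNr lerN2 ler_wpM2l// Mfun_le ?tau_ge0//.
Qed.

(** [PC_history_bounds] for approximations of phi, at a time t where f is
    continuous. *)
Lemma BPC_history_bounds t phi N : 0 <= t ->
  (forall e, 0 < e -> exists2 d : R, 0 < d &
    forall s psi, 0 <= s -> `|s - t| < d -> BPC psi ->
      bpc_norm (fun th => psi th - phi th) < d -> `|f s psi - f t phi| < e) ->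
  BPC phi -> 0 <= N ->
  ((forall th, - tau t <= th <= 0 -> - N <= phi th) -> f t phi <= lam2 t * N) /\
  ((forall th, - tau t <= th <= 0 -> phi th <= N) -> - (lam1 t * N) <= f t phi).
Proof.
move=> t0 fc bphi N0; have [l1 l2] := lam_ge0 t0.
have L0 : 0 < 1 + lam1 t + lam2 t by rewrite -addrA ltr_wpDr// addr_ge0.
have approx e : 0 < e -> exists psi, [/\ PC_at tau t psi,
    forall th, - tau t <= th <= 0 -> `|phi th - psi th| <= e / (1 + lam1 t + lam2 t) &
    `|f t psi - f t phi| < e].
  move=> e0; apply: BPC_PC_approx => //; first exact: tau_ge0.
  by rewrite divr_gt0.
have dle e (l : R) : 0 < e -> l = lam1 t \/ l = lam2 t -> l * (e / (1 + lam1 t + lam2 t)) <= e.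
  move=> e0 ll; rewrite mulrA ler_pdivrMr//.
  by rewrite mulrC ler_wpM2l ?ltW//; case: ll => ->; lra.
split=> H; apply/ler_addgt0Pr => e e0.
  have e20 : 0 < e / 2 by rewrite divr_gt0.
  have [psi [ppsi psile fpsi]] := approx _ e20.
  have NN : 0 <= N + e / 2 / (1 + lam1 t + lam2 t).
    by rewrite addr_ge0// ltW// divr_gt0.
  have [+ _] := PC_history_bounds t0 ppsi NN.
  have HH th : - tau t <= th <= 0 -> - (N + e / 2 / (1 + lam1 t + lam2 t)) <= psi th.
    move=> thI; have := H th thI; have := psile th thI.
    by rewrite ler_norml => /andP[]; lra.
  move=> /(_ HH); rewrite mulrDr; have := dle _ _ e20 (or_intror erefl).
  by move: fpsi; rewrite ltr_norml => /andP[]; lra.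
have e20 : 0 < e / 2 by rewrite divr_gt0.
have [psi [ppsi psile fpsi]] := approx _ e20.
have NN : 0 <= N + e / 2 / (1 + lam1 t + lam2 t).
  by rewrite addr_ge0// ltW// divr_gt0.
have [_ +] := PC_history_bounds t0 ppsi NN.
have HH th : - tau t <= th <= 0 -> psi th <= N + e / 2 / (1 + lam1 t + lam2 t).
  move=> thI; have := H th thI; have := psile th thI.
  by rewrite ler_norml => /andP[]; lra.
move=> /(_ HH); rewrite mulrDr; have := dle _ _ e20 (or_introl erefl).
by move: fpsi; rewrite ltr_norml => /andP[]; lra.
Qed.

End history_bounds.

(** * Removing the impulses from a solution *)

Section solutions.
Context {R : realType}.
Notation mu := (@lebesgue_measure R).
Variables (tau a : R -> R) (tk : nat -> R) (I_ : nat -> R -> R).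
Variables (f : R -> (R -> R) -> R) (ak bk : nat -> R) (lam1 lam2 : R -> R).
Hypothesis tau_ge0 : forall t : R, 0 <= t -> 0 <= tau t.
Hypothesis tk_incr : forall k, tk k < tk k.+1.
Hypothesis tk_lim : tk k @[k --> \oo] --> +oo.
Hypothesis I_0 : forall k, I_ k 0 = 0.
Hypothesis bk_gt0 : forall k, 0 < bk k.
Hypothesis I_bound : forall k x, bk k * x ^+ 2 <= x * (x + I_ k x) <= ak k * x ^+ 2.
Hypothesis lam_ge0 : forall t : R, 0 <= t -> 0 <= lam1 t /\ 0 <= lam2 t.
Hypothesis f_bound : forall t phi, 0 <= t -> PC_at tau t phi ->
  - lam1 t * Mfun tau t phi <= f t phi <= lam2 t * Mfun tau t (fun th => - phi th).
Local Notation cnt := (impulse_count tk_lim).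
Local Notation B := (Bfun tau tk bk).

Variables (t0 : R) (phi x : R -> R).
Hypothesis t0_ge0 : 0 <= t0.
Hypothesis phi_BPC : BPC phi.
Hypothesis x_sol : is_solution a f tk I_ t0 phi x.

(** When x (tk k) = 0 any number between bk k and ak k would do. *)
Definition jump_ratio k :=
  if x (tk k) == 0 then bk k else (x (tk k) + I_ k (x (tk k))) / x (tk k).
Local Notation c := jump_ratio.
Local Notation Q := (impulse_product tk_lim c).

Lemma jump_ratioE k : c k * x (tk k) = x (tk k) + I_ k (x (tk k)).
Proof.
rewrite /c; case: eqVneq => [->|x0]; last by rewrite mulfVK.
by rewrite mulr0 I_0 addr0.
Qed.

Lemma jump_ratio_bounds k : bk k <= c k <= ak k.
Proof.
rewrite /c; case: eqVneq => [_|x0].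
  by rewrite lexx/=; have /andP[] := I_bound k 1; rewrite expr1n !mulr1; exact: le_trans.
have x2 : 0 < x (tk k) ^+ 2 by rewrite exprn_even_gt0.
have /andP[h1 h2] := I_bound k (x (tk k)).
have cE : (x (tk k) + I_ k (x (tk k))) / x (tk k) =
    x (tk k) * (x (tk k) + I_ k (x (tk k))) / x (tk k) ^+ 2 by field.
by rewrite cE ler_pdivlMr// h1 ler_pdivrMr.
Qed.

Lemma jump_ratio_gt0 k : 0 < c k.
Proof. by have /andP[h _] := jump_ratio_bounds k; rewrite (lt_le_trans _ h). Qed.

Lemma jump_product_gt0 t : 0 < Q t.
Proof. exact/impulse_product_gt0/jump_ratio_gt0. Qed.

Definition impulse_free t := x t / Q t.
Local Notation y := impulse_free.

Lemma impulse_freeK t : x t = y t * Q t.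
Proof. by rewrite /y mulfVK// gt_eqF// jump_product_gt0. Qed.

Lemma solution_right_limit k : t0 <= tk k ->
  x s @[s --> (tk k)^'+] --> x (tk k) + I_ k (x (tk k)).
Proof.
move=> t0k; have [_ _ _ /(_ k t0k) xI _] := x_sol.
pose proof (cvgD xI (cvg_cst (x (tk k)))) as H; rewrite addrC.
by apply: (cvg_near_eq H); near=> s; rewrite /= /cst subrK.
Unshelve. all: by end_near. Qed.

(** At tk k both x and Q are multiplied by c k. *)
Lemma impulse_free_continuous : continuous_from t0 y.
Proof.
have [_ xl xr _ _] := x_sol; split=> t tt.
  have [[k tk']|H] := pselect (exists k, t = tk k).
    rewrite tk' in tt *.
    have -> : y (tk k) = (x (tk k) + I_ k (x (tk k))) / (Q (tk k) * c k).
      rewrite -jump_ratioE /y; field.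
      by rewrite !gt_eqF ?jump_ratio_gt0 ?jump_product_gt0.
    pose proof (cvgM (solution_right_limit tt)
      (cvg_cst (Q (tk k) * c k)^-1)) as H.
    apply: (cvg_near_eq H).
    apply: filterS (impulse_product_right_tk tk_incr tk_lim c k) => s Qs.
    by rewrite /y Qs.
  have ttk k : t != tk k by apply/eqP => tE; apply: H; exists k.
  pose proof (cvgM (xr t tt ttk) (cvg_cst (Q t)^-1)) as H'.
  apply: (cvg_near_eq H').
  by apply: filterS (impulse_product_right tk_incr tk_lim c ttk) => s Qs; rewrite /y Qs.
pose proof (cvgM (xl t tt) (cvg_cst (Q t)^-1)) as H'.
apply: (cvg_near_eq H').
by apply: filterS (impulse_product_left tk_incr tk_lim c t) => s Qs; rewrite /y Qs.
Qed.

Lemma solution_PC b : PC_on t0 b x.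
Proof.
have [_ xl xr xI _] := x_sol; split; first split.
- exists (t0 :: [seq tk k | k <- iota 0 (cnt b).+1]) => t; rewrite in_itv -[_ && _]/(t0 <= t <= b).
  move=> /andP[t0t tb]; rewrite in_cons negb_or => /andP[tt0 tD].
  have ttk k : t != tk k.
    apply/eqP => tE; move/negP : tD; apply; rewrite tE map_f//.
    by rewrite mem_iota/= add0n ltnS -[k](impulse_count_tk tk_incr tk_lim) impulse_count_le// -tE.
  suff xt : x s @[s --> t] --> x t by apply: cvg_trans xt; apply: cvg_app; exact: cvg_within.
  apply/left_right_continuousP; split; last exact: xr.
  by apply: xl; rewrite lt_neqAle eq_sym tt0.
- move=> t; rewrite in_itv/= => /andP[t0t _]; apply/cvg_ex.
  have [[k tE]|H] := pselect (exists k, t = tk k).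
    by exists (x (tk k) + I_ k (x (tk k))); rewrite tE; apply: solution_right_limit; rewrite -tE.
  by exists (x t); apply: xr => // k; apply/eqP => tE; apply: H; exists k.
- by move=> t; rewrite in_itv/= => /andP[t0t _]; apply/cvg_ex; exists (x t); exact: xl.
- by move=> t; rewrite in_itv/= => /andP[t0t _]; exact: xl.
Qed.

Lemma segment_PC t : t0 <= t - tau t -> PC_at tau t (segment x t).
Proof.
move=> tt; apply: PC_on_segment; rewrite addr0.
exact: (PC_on_restrict tt (lexx _) (solution_PC t)).
Qed.

Lemma segment_BPC t : t0 <= t -> BPC (segment x t).
Proof.
move=> t0t; have [xphi _ _ _ _] := x_sol.
apply: (BPC_segment phi_BPC xphi t0t (solution_PC t)).
by have [M HM] := PC_bounded (solution_PC t).1; exists M.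
Qed.

Lemma jump_product_ratio r s : r <= s ->
  Q r <= Q s * \prod_(cnt r <= k < cnt s) (bk k)^-1.
Proof.
move=> rs; rewrite (impulse_product_split tk_incr tk_lim c rs) -mulrA -big_split/=.
apply: ler_peMr; first by rewrite ltW// jump_product_gt0.
apply: (big_ind (fun z : R => 1 <= z)) => //; first exact: mulr_ege1.
by move=> k _; rewrite ler_pdivlMr// mul1r; case/andP: (jump_ratio_bounds k).
Qed.

(** The quotient Q r / Q s is the product of the (c k)^-1 <= (bk k)^-1 over the
    impulses in [r, s[.  This is the origin of the factor B in the gains. *)
Lemma jump_product_window s r : 0 <= s -> s - tau s <= r <= s -> Q r <= Q s * B s.
Proof.
move=> s0 rI; have /andP[_ rs] := rI.
apply: (le_trans (jump_product_ratio rs)).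
apply: ler_wpM2l; first by rewrite ltW// jump_product_gt0.
exact: Bfun_ub.
Qed.

Section delay_inequalities.
Variable E : set R.
Hypothesis E_tk : range tk `<=` E.
Hypothesis f_E : forall t psi, 0 <= t -> ~ E t -> BPC psi ->
  forall e : R, 0 < e -> exists2 d : R, 0 < d &
    forall s chi, 0 <= s -> `|s - t| < d -> BPC chi ->
      bpc_norm (fun th => chi th - psi th) < d -> `|f s chi - f t psi| < e.

Lemma impulse_free_left_derivative s : t0 < s -> (forall k, s != tk k) ->
  exists2 d, has_left_derivative y s d & d + a s * y s = f s (segment x s) / Q s.
Proof.
move=> ts stk; have [_ _ _ _ /(_ s ts stk)[d xd dE]] := x_sol.
exists (d / Q s); last by rewrite -dE /y mulrDl mulrA.
apply: (@has_left_derivative_eq_near _ (fun v => x v * (Q s)^-1)) => //.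
  by apply: filterS (impulse_product_left tk_incr tk_lim c s) => v Qv; rewrite /y Qv.
exact: has_left_derivativeMr.
Qed.

(** If y >= - N on the window of s, then x >= - N * Q s * B s there by
    [jump_product_window].  The resulting bound on f, divided by Q s, contains N
    with the gain lam2 s * B s. *)
Lemma impulse_free_delay_inequality :
  delay_inequality tau a t0 E (fun s => lam2 s * B s) y /\
  delay_inequality tau a t0 E (fun s => lam1 s * B s) (fun s => - y s).
Proof.
have key s N : t0 < s -> ~ E s -> 0 <= N ->
  ((forall r, s - tau s <= r <= s -> - N <= y r) ->
     f s (segment x s) / Q s <= lam2 s * B s * N) /\
  ((forall r, s - tau s <= r <= s -> y r <= N) ->
     - (lam1 s * B s * N) <= f s (segment x s) / Q s).
  move=> ts Es N0; have s0 : 0 <= s by rewrite (le_trans t0_ge0)// ltW.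
  have Qs := jump_product_gt0 s.
  have B0 : 0 <= B s.
    by rewrite (le_trans ler01)// (Bfun_ge1 tk_incr tk_lim bk_gt0 tau_ge0).
  have N'0 : 0 <= N * (Q s * B s) by rewrite mulr_ge0// mulr_ge0// ltW.
  have [h1 h2] := BPC_history_bounds tau_ge0 lam_ge0 f_bound s0
    (f_E s0 Es (segment_BPC (ltW ts))) (segment_BPC (ltW ts)) N'0.
  have win th : - tau s <= th <= 0 -> s - tau s <= s + th <= s.
    by move=> /andP[th1 th2]; rewrite lerD2l th1 gerDl.
  split=> H.
    rewrite ler_pdivrMr// (_ : _ * Q s = lam2 s * (N * (Q s * B s))); last by ring.
    apply: h1 => th /win thI; rewrite /segment impulse_freeK.
    apply: (@le_trans _ _ (- N * Q (s + th))).
      by rewrite mulNr lerN2 ler_wpM2l// jump_product_window.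
    by rewrite ler_wpM2r ?H// ltW// jump_product_gt0.
  rewrite ler_pdivlMr// (_ : _ * Q s = - (lam1 s * (N * (Q s * B s)))); last by ring.
  apply: h2 => th /win thI; rewrite /segment impulse_freeK.
  apply: (@le_trans _ _ (N * Q (s + th))).
    by rewrite ler_wpM2r ?H// ltW// jump_product_gt0.
  by rewrite ler_wpM2l// jump_product_window.
have stk s : ~ E s -> forall k, s != tk k.
  by move=> Es k; apply/eqP => sE; apply: Es; apply: E_tk; exists k.
split=> s ts Es; have [d yd dE] := impulse_free_left_derivative ts (stk s Es).
  by exists d => // N N0 /(key s N ts Es N0).1; rewrite dE.
exists (- d); first exact: has_left_derivativeN.
move=> N N0 H; rewrite mulrN -opprD dE lerNl.
by apply: (key s N ts Es N0).2 => r /H; rewrite lerN2.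
Qed.

End delay_inequalities.

End solutions.

(** * Integrals bounded by the decrease of a function *)

Section nonincreasing_integral.
Context {R : realType}.
Notation mu := (@lebesgue_measure R).

Lemma limn_einf_le (u : nat -> \bar R) (l : \bar R) :
  (forall n, (u n <= l)%E) -> (limn_einf u <= l)%E.
Proof.
move=> ul; rewrite limn_einf_lim; apply: lime_le; first exact: is_cvg_einfs.
apply: nearW => n; apply: le_trans (ul n).
by apply: ereal_inf_lbound; exists n => /=.
Qed.

Lemma continuous_from_shift (f : R -> R) (h : R) :
  continuous_from 0 f -> continuous_from h (fun s => f (s - h)).
Proof.
move=> [fr fl]; split=> t ht.
  move=> U /= HU; have := @near_right_translate _ (- h) t (fun s => U (f s)).
  by apply; apply: fr; rewrite ?subr_ge0.
move=> U /= HU; have := @near_left_translate _ (- h) t (fun s => U (f s)).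
by apply; apply: fl; rewrite ?subr_gt0.
Qed.

Variable (Y : R -> R).
Hypothesis Y_ge0 : forall t : R, 0 <= t -> 0 <= Y t.
Hypothesis Y_cont : {within `[0, +oo[, continuous Y}.
Hypothesis Y_nincr : forall s t : R, 0 <= s -> s <= t -> Y t <= Y s.

(** With G a primitive of Y, the integral of the difference quotient is the mean of Y
    over [v - h, v] minus its mean over [u - h, u]. *)
Lemma integral_decrement_le (v u h : R) : 0 < h -> h <= v -> v < u ->
  (\int[mu]_(s in `[v, u]) (h^-1 * (Y (s - h) - Y s))%:E <= (Y 0)%:E)%E.
Proof.
move=> h0 hv vu.
have v0 : 0 < v by rewrite (lt_le_trans h0).
have u0 : 0 < u by rewrite (lt_trans v0).
have hu : h < u by rewrite (le_lt_trans hv).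
pose G := primitive0 Y; pose F s := h^-1 * (G (s - h) - G s).
have dG (t : R) : 0 < t -> is_derive t 1 G (Y t).
  by move=> t0; have [d1 d2] := primitive0_derive Y_cont t0; exact: is_derive_derive1.
have cY := continuous_from_within Y_cont.
have [cGr cGl] : continuous_from 0 G by exact: primitive0_continuous.
have [cGhr cGhl] : continuous_from h (fun s => G (s - h)) by exact: continuous_from_shift.
have [cYhr cYhl] : continuous_from h (fun s => Y (s - h)) by exact: continuous_from_shift.
have dF (t : R) : h < t -> is_derive t 1 F (h^-1 * (Y (t - h) - Y t)).
  move=> ht; have t0 : 0 < t by rewrite (lt_trans h0).
  have d1 : is_derive t 1 (fun s => G (s - h)) (Y (t - h)).
    have dsub : is_derive t 1 (fun s => s - h) 1.
      by have := is_deriveB (is_derive_id t 1) (is_derive_cst h t 1); rewrite subr0.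
    have th : 0 < t - h by rewrite subr_gt0.
    have := @is_derive1_comp _ G (fun s => s - h) t _ _ (dG _ th) dsub.
    by rewrite mulr1.
  have d2 : is_derive t 1 (fun s => G (s - h) - G s) (Y (t - h) - Y t).
    exact: is_deriveB d1 (dG t t0).
  exact: is_deriveZ d2.
have cF : continuous_from h F.
  split=> t ht.
    apply: cvgMr; apply: cvgB; first exact: cGhr.
    by apply: cGr; rewrite (le_trans (ltW h0)).
  apply: cvgMr; apply: cvgB; first exact: cGhl.
  by apply: cGl; rewrite (lt_trans h0).
have cf : continuous_from h (fun s => h^-1 * (Y (s - h) - Y s)).
  split=> t ht.
    apply: cvgMr; apply: cvgB; first exact: cYhr.
    by apply: cY.1; rewrite (le_trans (ltW h0)).
  apply: cvgMr; apply: cvgB; first exact: cYhl.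
  by apply: cY.2; rewrite (lt_trans h0).
rewrite (@continuous_FTC2 _ _ F)//; last 3 first.
- exact: (within_continuous_from hv cf).
- split.
  + move=> t; rewrite in_itv/= => /andP[vt _].
    by have [] := dF t (le_lt_trans hv vt).
  + exact: cF.1.
  + by apply: cF.2.
- move=> t; rewrite in_itv/= => /andP[vt _].
  by have [_ <-] := dF t (le_lt_trans hv vt); rewrite derive1E.
rewrite -EFinB lee_fin /F -mulrBr ler_pdivrMl//.
have Gv : G v <= G (v - h) + Y 0 * (v - (v - h)).
  apply: (@threshold_growth _ set0 G) => //.
  - by rewrite gerBl ltW.
  - exact: Y_ge0.
  - by move=> r /andP[vr _]; apply: cGr; rewrite (le_trans _ vr)// subr_ge0.
  - by move=> r /andP[vr _]; apply: cGl; rewrite (le_lt_trans _ vr)// subr_ge0.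
  - move=> r /andP[vr _] _ _; have r0 : 0 < r by rewrite (le_lt_trans _ vr)// subr_ge0.
    have [d1 d2] := primitive0_derive Y_cont r0.
    exists (Y r); first by rewrite -d2; exact: derivable_has_left_derivative.
    by apply: Y_nincr => //; exact: ltW.
have Gu : G (u - h) <= G u.
  by apply: (primitive0_le Y_ge0 Y_cont); rewrite subr_ge0 (ltW hu) gerBl ltW.
by move: Gv Gu; lra.
Qed.

(** Fatou for the difference quotients of Y with steps 1 / (n + 1), whose integrals
    are bounded by [integral_decrement_le]: the integral of - Y' is at most the
    decrease of Y, which is all that holds for a monotone function in general. *)
Lemma left_derivative_integral_bound (g : R -> R) (E : set R) (C v u : R) :
  countable E -> 0 <= C -> 1 <= v -> v < u -> measurable_fun `[v, u] g ->
  (forall s, v <= s <= u -> ~ E s ->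
    exists2 l, has_left_derivative Y s l & `|g s| <= - (C * l)) ->
  (\int[mu]_(s in `[v, u]) `|g s|%:E <= (C * Y 0)%:E)%E.
Proof.
move=> cE C0 v1 vu mg gl.
pose h n : R := n.+1%:R^-1.
have h0 n : 0 < h n by rewrite invr_gt0.
have h1 n : h n <= 1 by rewrite invf_le1// ler1n.
pose F n s := (C * ((h n)^-1 * (Y (s - h n) - Y s)))%:E.
have vpos : 0 < v by rewrite (lt_le_trans ltr01).
have hv n s : v <= s -> 0 <= s - h n by move=> vs; rewrite subr_ge0 (le_trans (h1 n))// (le_trans v1).
have f0 n s : v <= s -> 0 <= (h n)^-1 * (Y (s - h n) - Y s).
  move=> vs; apply: mulr_ge0; first by rewrite invr_ge0 ltW.
  by rewrite subr_ge0; apply: Y_nincr; [exact: hv|rewrite gerBl ltW].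
have F0 n s : `[v, u]%classic s -> (0 <= F n s)%E.
  by rewrite /= in_itv/= => /andP[vs _]; rewrite lee_fin mulr_ge0// f0.
have mf n : measurable_fun `[v, u] (fun s => (h n)^-1 * (Y (s - h n) - Y s)).
  have cY := continuous_from_within Y_cont.
  apply: measurable_funM; first exact: measurable_cst.
  apply: measurable_funB; apply: subspace_continuous_measurable_fun => //.
    apply: (@within_continuous_from _ _ (h n)); first by rewrite (le_trans (h1 n)).
    exact: continuous_from_shift.
  by apply: (@within_continuous_from _ _ 0) => //; exact: ltW.
have mF n : measurable_fun `[v, u] (F n).
  by apply/measurable_EFinP; apply: measurable_funM => //; exact: measurable_cst.
have intF n : (\int[mu]_(s in `[v, u]) F n s <= (C * Y 0)%:E)%E.
  rewrite /F; under eq_integral do rewrite EFinM.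
  rewrite ge0_integralZl//; last 2 first.
  - by apply/measurable_EFinP; exact: mf.
  - by move=> s; rewrite /= in_itv/= => /andP[vs _]; rewrite lee_fin f0.
  rewrite EFinM lee_wpmul2l ?lee_fin//.
  by apply: integral_decrement_le => //; rewrite (le_trans (h1 n)).
have Fle : (\int[mu]_(s in `[v, u]) limn_einf (F ^~ s) <= (C * Y 0)%:E)%E.
  apply: (le_trans (fatou mu _ mF F0)) => //.
  exact: limn_einf_le.
apply: le_trans Fle; apply: ae_ge0_le_integral => //.
- by apply/measurable_EFinP; apply: measurableT_comp.
- move=> s sI; rewrite limn_einf_lim; apply: lime_ge; first exact: is_cvg_einfs.
  apply: nearW => n; apply: le_ereal_inf_tmp => _ [k /= _ <-]; exact: F0.
- have -> : (fun s => limn_einf (F ^~ s)) =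
      (fun s => - limn_esup ((fun n t => - F n t) ^~ s))%E.
    apply/funext => s; rewrite -limn_einfN; congr limn_einf.
    by apply/funext => n; rewrite /comp oppeK.
  apply: measurableT_comp => //; apply: measurable_fun_limn_esup => n.
  by apply: measurableT_comp => //; exact: mF.
exists E; split.
- by apply: countable_measurable.
- exact: countable_lebesgue_measure0.
- move=> s /= H; apply: contrapT => Es; apply: H; rewrite in_itv/= => sI.
  have [l Yl gs] := gl s sI Es.
  have cF : F n s @[n --> \oo] --> (- (C * l))%:E.
    apply: cvg_EFin; first by apply: nearW.
    rewrite -mulrN; apply: cvgMr.
    have cl : (Y (s - h n) - Y s) / (- h n) @[n --> \oo] --> l.
      move=> U /Yl [e /= e0 HU].
      have := near_infty_natSinv_lt (PosNum e0); apply: filterS => n /= hn.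
      apply: HU => /=; last by rewrite oppr_lt0.
      by rewrite sub0r opprK ger0_norm// ltW.
    pose proof (cvgN cl) as Ncl; apply: (cvg_near_eq Ncl); apply: nearW => n /=.
    by rewrite invrN mulrN opprK mulrC.

  by rewrite (cvg_limn_einf_sup cF).1 lee_fin.
Qed.

End nonincreasing_integral.

(** * Stability and attractivity *)

Section stability.
Context {R : realType}.
Notation mu := (@lebesgue_measure R).
Variables (tau a : R -> R) (tk : nat -> R) (I_ : nat -> R -> R).
Variables (f : R -> (R -> R) -> R) (ak bk : nat -> R) (lam1 lam2 : R -> R) (T : R).
Hypothesis tau_ge0 : forall t : R, 0 <= t -> 0 <= tau t.
Hypothesis tau_cont : {within `[0, +oo[, continuous tau}.
Hypothesis tau_lim : t - tau t @[t --> +oo] --> +oo.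
Hypothesis tau_mono : forall s t : R, 0 <= s -> s <= t -> s - tau s <= t - tau t.
Hypothesis tk_incr : forall k, tk k < tk k.+1.
Hypothesis tk_lim : tk k @[k --> \oo] --> +oo.
Hypothesis a_ge0 : forall t : R, 0 <= t -> 0 <= a t.
Hypothesis a_cont : {within `[0, +oo[, continuous a}.
Hypothesis I_0 : forall k, I_ k 0 = 0.
Hypothesis f_hist : depends_on_history tau f.
Hypothesis f_cont : piecewise_continuous_BPC f.
Hypothesis ak_gt0 : forall k, 0 < ak k.
Hypothesis bk_gt0 : forall k, 0 < bk k.
Hypothesis I_bound : forall k x, bk k * x ^+ 2 <= x * (x + I_ k x) <= ak k * x ^+ 2.
Hypothesis lam_ge0 : forall t : R, 0 <= t -> 0 <= lam1 t /\ 0 <= lam2 t.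
Hypothesis lam1_PC : piecewise_continuous_nneg lam1.
Hypothesis lam2_PC : piecewise_continuous_nneg lam2.
Hypothesis f_bound : forall t phi, 0 <= t -> PC_at tau t phi ->
  - lam1 t * Mfun tau t phi <= f t phi <= lam2 t * Mfun tau t (fun th => - phi th).
Hypothesis T_ge0 : 0 <= T.
Hypothesis T_tau : 0 <= T - tau T.
Hypothesis alpha1_fin : alpha tau a tk bk T lam1 \is a fin_num.
Hypothesis alpha2_fin : alpha tau a tk bk T lam2 \is a fin_num.
Local Notation cnt := (impulse_count tk_lim).
Local Notation B := (Bfun tau tk bk).
Local Notation al1 := (fine (alpha tau a tk bk T lam1)).
Local Notation al2 := (fine (alpha tau a tk bk T lam2)).
Local Notation L1 := (fun s => lam1 s * B s).
Local Notation L2 := (fun s => lam2 s * B s).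
Hypothesis alpha12 : al1 * al2 < 1.
Variable Pm : R.
Hypothesis Pm_gt0 : 0 < Pm.
Hypothesis ak_prod : forall n, \prod_(k < n) ak k <= Pm.

(** A single countable set gathers the impulse times, the discontinuities of f in
    time and those of the gains. *)
Lemma exceptional_set : exists E : set R,
  [/\ countable E, range tk `<=` E,
      forall t psi, 0 <= t -> ~ E t -> BPC psi ->
        forall e : R, 0 < e -> exists2 d : R, 0 < d &
          forall s chi, 0 <= s -> `|s - t| < d -> BPC chi ->
            bpc_norm (fun th => chi th - psi th) < d -> `|f s chi - f t psi| < e,
      admissible_gain tau a T E L1 al1 & admissible_gain tau a T E L2 al2].
Proof.
have [D [Dfin fD _ _]] := f_cont.
have [E1 cE1 adm1] := gain_alpha tau_ge0 tau_cont tau_mono tk_incr tk_lim bk_gt0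
  (fun t h => (lam_ge0 h).1) lam1_PC alpha1_fin.
have [E2 cE2 adm2] := gain_alpha tau_ge0 tau_cont tau_mono tk_incr tk_lim bk_gt0
  (fun t h => (lam_ge0 h).2) lam2_PC alpha2_fin.
pose D' := \bigcup_n (D `&` `[0, n%:R]).
exists (range tk `|` (D' `|` (E1 `|` E2))); split.
- apply: countable_setU.
    by apply: (sub_countable (card_image_le _ _)); exact: countableP.
  apply: countable_setU; last exact: countable_setU.
  by apply: bigcup_countable => // n _; apply: finite_set_countable.
- by left.
- move=> t psi t0 Et; apply: fD => // Dt; apply: Et; right; left.
  exists (Num.trunc t).+1 => //; split=> //; rewrite /= in_itv/= t0/=.
  by rewrite ltW// truncnS_gt.
- by apply: adm1 => t Et; right; right; left.
- by apply: adm2 => t Et; right; right; right.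
Qed.

Lemma jump_product_le x t : impulse_product tk_lim (jump_ratio tk I_ bk x) t <= Pm.
Proof.
apply: le_trans (ak_prod (cnt t)); rewrite /impulse_product big_mkord.
apply: ler_prod => k _; rewrite ltW ?(jump_ratio_gt0 tk bk_gt0 I_bound)//.
by have /andP[] := jump_ratio_bounds tk I_bound x k.
Qed.

(** [delay_growth] covers the times whose windows reach back to the initial
    function, [delay_trap] the later ones. *)
Lemma impulse_free_bound t0 : 0 <= t0 -> exists2 C : R, 0 < C &
  forall phi x M, BPC phi -> is_solution a f tk I_ t0 phi x -> 0 < M ->
    (forall s, s <= 0 -> `|phi s| <= M) ->
    forall t, t0 <= t -> `|impulse_free I_ bk tk_lim x t| <= C * M.
Proof.
move=> t00; have [E [cE Etk fE adm1 adm2]] := exceptional_set.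
have [t1 Tt1 Ht1] := eventually_shift T tau_lim t0.
have t0t1 : t0 <= t1 - tau t1 by exact: Ht1.
have t10 : 0 <= t1 by rewrite (le_trans T_ge0).
have t0t1' : t0 <= t1 by rewrite (le_trans t0t1)// gerBl tau_ge0.
have [M1 HM1] := gain_bounded tau_ge0 tk_incr tk_lim bk_gt0 lam1_PC t10.
have [M2 HM2] := gain_bounded tau_ge0 tk_incr tk_lim bk_gt0 lam2_PC t10.
pose Lb := Num.max 0 (Num.max M1 M2).
have Lb0 : 0 <= Lb by rewrite le_max lexx.
have LLb v : t0 < v <= t1 -> L1 v <= Lb /\ L2 v <= Lb.
  move=> /andP[tv vt]; have vI : 0 <= v <= t1 by rewrite vt ltW// (le_lt_trans t00).
  by rewrite !le_max HM1// HM2// !orbT.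
have [C1 C11 HC1] := @delay_growth _ tau a t0 E t00 a_ge0 cE L1 L2 Lb t1 Lb0 LLb.
have C10 : 0 < C1 by rewrite (lt_le_trans ltr01).
pose W0 := inverse_bound bk (cnt t0).
have W01 : 1 <= W0 by exact: inverse_bound_ge1.
have W00 : 0 < W0 by rewrite (lt_le_trans ltr01).
pose m := Num.max 1 al1 + Num.max 1 al2.
have m1 : 1 <= m by rewrite ler_wpDr// ?le_max ?ler01 ?lexx.
have m0 : 0 < m by rewrite (lt_le_trans ltr01).
exists (m * (C1 * W0)); first by rewrite !mulr_gt0.
move=> phi x M bphi xsol M0 phiM.
set y := impulse_free I_ bk tk_lim x.
have cy : continuous_from t0 y by exact: impulse_free_continuous xsol.
have [dy2 dy1] := impulse_free_delay_inequality tau_ge0 tk_incr tk_lim bk_gt0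
  I_bound lam_ge0 f_bound t00 bphi xsol Etk fE.
have K0 : 0 < W0 * M by rewrite mulr_gt0.
have yinit v : v <= t0 -> `|y v| <= W0 * M.
  move=> vt; have [xphi _ _ _ _] := xsol.
  have Qv := jump_product_gt0 tk_lim bk_gt0 I_bound x v.
  rewrite /y /impulse_free normrM normfV (gtr0_norm Qv) mulrC.
  apply: ler_pM => //; first by rewrite invr_ge0 ltW.
    apply: le_trans (inverse_prod_le bk_gt0 (_ : (0 <= cnt v <= cnt t0)%N)).
      rewrite -prodfV; apply: ler_prod => k _.
      rewrite invr_ge0 ltW ?(jump_ratio_gt0 tk bk_gt0 I_bound)//=.
      rewrite lef_pV2 ?posrE ?(jump_ratio_gt0 tk bk_gt0 I_bound)//.
      by have /andP[] := jump_ratio_bounds tk I_bound x k.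
    by rewrite impulse_count_le.
  by rewrite -[v](subrKC t0) xphi ?phiM// subr_le0.
have y1 v : v <= t1 -> `|y v| <= C1 * (W0 * M).
  exact: (HC1 y (W0 * M) dy2 dy1 cy (ltW K0) yinit).
have K1 : 0 < C1 * (W0 * M) by rewrite mulr_gt0.
move=> t t0t; rewrite -mulrA -(mulrA C1); have [tt1|t1t] := leP t t1.
  by rewrite (le_trans (y1 t tt1))// ler_peMl// ltW.
apply: (@delay_trap _ tau a T t0 E t00 tau_ge0 tau_mono a_ge0 a_cont T_ge0 T_tau cE
  L1 L2 al1 al2 y t0 t1 _ adm1 adm2 (ltW alpha12) dy2 dy1 cy) => //.
- by move=> v /andP[_ vt1]; exact: y1.
- by rewrite (le_trans _ t0t)// gerBl tau_ge0.
Qed.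

Lemma solution_bound t0 : 0 <= t0 -> exists2 C : R, 0 < C &
  forall phi x M, BPC phi -> is_solution a f tk I_ t0 phi x -> 0 < M ->
    (forall s, s <= 0 -> `|phi s| <= M) -> forall t, t0 <= t -> `|x t| <= C * M.
Proof.
move=> t00; have [C C0 HC] := impulse_free_bound t00.
exists (C * Pm); first exact: mulr_gt0.
move=> phi x M bphi xsol M0 phiM t t0t.
have Qt := jump_product_gt0 tk_lim bk_gt0 I_bound x t.
rewrite (impulse_freeK tk_lim bk_gt0 I_bound x t) normrM (gtr0_norm Qt) mulrAC.
apply: ler_pM => //; first exact: ltW.
- exact: (HC phi).
- exact: jump_product_le.
Qed.

Lemma solutions_stable : zero_stable a f tk I_.
Proof.
move=> e t0 e0 t00; have [C C0 HC] := solution_bound t00.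
exists (e / (2 * C)); first by rewrite divr_gt0// mulr_gt0.
move=> phi x bphi phid xsol t t0t.
apply: (@le_lt_trans _ _ (C * (e / (2 * C)))); last first.
  by rewrite (_ : _ * _ = e / 2); [lra|field; rewrite gt_eqF].
apply: (HC phi) => //; first by rewrite divr_gt0// mulr_gt0.
move=> s s0; apply: le_trans (ltW phid).
have [_ [M HM]] := bphi; apply: ub_le_sup.
  by exists M => _ [r + <-]; rewrite /= in_itv/=; exact: HM.
by exists s => //=; rewrite in_itv.
Qed.

Section eventual_sign.
Variables (t0 : R) (phi x : R -> R).
Hypothesis x_sol : is_solution a f tk I_ t0 phi x.
Local Notation y := (impulse_free I_ bk tk_lim x).
Local Notation c := (jump_ratio tk I_ bk x).
Local Notation Q := (impulse_product tk_lim c).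
Local Notation p := (impulse_product tk_lim ak).

(* y keeps the sign sg from t1 on, and the windows of times t >= t2 start after t1 *)
Variables (sg t1 : R).
Hypothesis sg_norm : sg = 1 \/ sg = -1.
Hypothesis t01 : t0 <= t1.
Hypothesis y_sign : forall t, t1 <= t -> 0 < sg * y t.
Local Notation Y := (fun t => sg * y t).

Variable t2 : R.
Hypothesis t2_ge1 : 1 <= t2.
Hypothesis t12 : t1 <= t2.
Hypothesis t2_window : forall t, t2 <= t -> t1 <= t - tau t.

Let Q_gt0 t : 0 < Q t.
Proof. exact: (jump_product_gt0 tk_lim bk_gt0 I_bound x t). Qed.

Let t2_ge0 : 0 <= t2.
Proof. by rewrite (le_trans ler01). Qed.

(** With N = 0 the bounds of [PC_history_bounds] give f the sign opposite to that of
    the history.  The whole window lies beyond t0, where the history is piecewise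
    continuous, so there is no exceptional time. *)
Lemma feedback_opposes_sign t : t2 <= t -> sg * f t (segment x t) <= 0.
Proof.
move=> tt; have t_ge0 : 0 <= t by rewrite (le_trans t2_ge0).
have xPC : PC_at tau t (segment x t).
  by apply: (segment_PC tk_incr tk_lim x_sol); rewrite (le_trans t01)// t2_window.
have [h1 h2] := PC_history_bounds tau_ge0 lam_ge0 f_bound t_ge0 xPC (lexx 0).
have ys th : - tau t <= th <= 0 -> 0 < sg * y (t + th).
  move=> /andP[th1 _]; apply: y_sign; apply: (le_trans (t2_window tt)).
  by rewrite lerD2l.
move: h1 h2; rewrite oppr0 !mulr0 oppr0 => h1 h2.
case: sg_norm ys => -> ys.
  rewrite mul1r; apply: h1 => th /ys; rewrite mul1r => y0.
  by rewrite /segment (impulse_freeK tk_lim bk_gt0 I_bound x) mulr_ge0// ltW.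
rewrite mulN1r oppr_le0; apply: h2 => th /ys; rewrite mulN1r oppr_gt0 => y0.
by rewrite /segment (impulse_freeK tk_lim bk_gt0 I_bound x) mulr_le0_ge0// ltW.
Qed.

Lemma signed_left_derivative t : t1 < t -> ~ range tk t ->
  exists2 l, has_left_derivative Y t l &
    l + a t * Y t = sg * f t (segment x t) / Q t.
Proof.
move=> t1t ttk; have t0t : t0 < t by rewrite (le_lt_trans t01).
have [|d yd dE] := impulse_free_left_derivative bk tk_incr tk_lim x_sol t0t.
  by move=> k; apply/eqP => tE; apply: ttk; exists k.
exists (d * sg); last by rewrite -mulrA -dE; ring.
apply: (@has_left_derivative_eq_near _ (fun s => y s * sg)).
- by apply: nearW => s; rewrite mulrC.
- by rewrite mulrC.
- exact: has_left_derivativeMr.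
Qed.

Let y_cont : continuous_from t0 y.
Proof. exact: impulse_free_continuous x_sol. Qed.

Lemma signed_continuous : continuous_from t0 Y.
Proof. by split=> t tt; apply: cvgMr; [exact: y_cont.1|exact: y_cont.2]. Qed.

Lemma signed_nonincreasing s t : t2 <= s -> s <= t ->
  expR (primitive0 a t - primitive0 a s) * Y t <= Y s.
Proof.
move=> t2s st; have s0 : 0 <= s by rewrite (le_trans t2_ge0).
have t0s : t0 <= s by rewrite (le_trans t01)// (le_trans t12).
have [er el] := expR_primitive0_continuous a_cont (primitive0 a s).
have [Yr Yl] := signed_continuous.
suff : expR (primitive0 a t - primitive0 a s) * Y t <= Y s + 0 * (t - s).
  by rewrite mul0r addr0.
apply: (@threshold_growth _ (range tk)
  (fun v => expR (primitive0 a v - primitive0 a s) * Y v)) => //.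
- by apply: (sub_countable (card_image_le _ _)); exact: countableP.
- by rewrite subrr expR0 mul1r.
- move=> r /andP[sr _]; apply: cvgM; first by apply: er; rewrite (le_trans s0).
  by apply: Yr; rewrite (le_trans t0s).
- move=> r /andP[sr _]; apply: cvgM; first by apply: el; rewrite (le_lt_trans s0).
  by apply: Yl; rewrite (le_lt_trans t0s).
move=> r /andP[sr _] rtk _.
have t2r : t2 <= r by rewrite (le_trans t2s)// ltW.
have [|l Yl' lE] := @signed_left_derivative r _ rtk.
  by rewrite (le_lt_trans t12)// (le_lt_trans t2s).
have r0 : 0 < r by rewrite (le_lt_trans s0).
have er' := @expR_primitive0_left_derivative _ _ a_cont (primitive0 a s) _ r0.
eexists; first exact: has_left_derivativeM er' Yl'.
rewrite (_ : _ + _ = expR (primitive0 a r - primitive0 a s) * (l + a r * (sg * y r))); last by ring.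
rewrite lE pmulr_rle0 ?expR_gt0// pmulr_lle0 ?invr_gt0//.
exact: feedback_opposes_sign.
Qed.

Lemma signed_le s t : t2 <= s -> s <= t -> Y t <= Y s.
Proof.
move=> t2s st; apply: le_trans (signed_nonincreasing t2s st).
apply: ler_peMl; first by rewrite ltW// y_sign// (le_trans t12)// (le_trans t2s).
rewrite -expR0 ler_expR subr_ge0.
by apply: (primitive0_le a_ge0 a_cont); rewrite (le_trans t2_ge0).
Qed.

Lemma vanishing_damped : (\int[mu]_(u in `[0%R, +oo[) (a u)%:E = +oo)%E ->
  Y t @[t --> +oo] --> (0 : R).
Proof.
move=> aoo; apply/cvgrPdist_le => e e0.
have Y2 : 0 < Y t2 by exact: y_sign.
have [t3 t30 Ht3] := primitive0_unbounded a_ge0 a_cont aoo (primitive0 a t2 + Y t2 / e).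
near=> t.
have t3t : t3 <= t by near: t; exact: (nbhs_pinfty_ge (num_real t3)).
have t2t : t2 <= t by near: t; exact: (nbhs_pinfty_ge (num_real t2)).
have Yt : 0 < Y t by apply: y_sign; rewrite (le_trans t12).
rewrite sub0r normrN ger0_norm ?(ltW Yt)//.
have : Y t2 / e * Y t <= Y t2.
  apply: le_trans (signed_nonincreasing (lexx t2) t2t).
  apply: ler_wpM2r; first exact: ltW.
  apply: le_trans (expR_ge1Dx _).
  by rewrite (le_trans _ (_ : primitive0 a t - primitive0 a t2 <= _))// ?lerDr// lerBrDl Ht3.
by rewrite mulrAC ler_pdivrMr// ler_pM2l.
Unshelve. all: by end_near. Qed.

Lemma impulse_count_pinfty : cnt t @[t --> +oo] --> \oo.
Proof.
move=> U [N _ HU]; apply: filterS (nbhs_pinfty_gt (num_real (tk N))) => t tNt.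
by apply: HU; apply: ltnW; rewrite impulse_countP.
Qed.

(** Up to sign, x is the product of three convergent factors: p, the ratio Q / p, which
    is nonincreasing because c k <= ak k, and Y. *)
Lemma signed_solution_cvg (P : R) : (\prod_(k < n) ak k) @[n --> \oo] --> P ->
  exists l : R, x t @[t --> +oo] --> l.
Proof.
move=> aP; pose Z t := Y t * (Q t / p t).
have p0 t : 0 < p t by exact: impulse_product_gt0.
have Qp s t : s <= t -> Q t / p t <= Q s / p s.
  move=> st; rewrite ler_pdivrMr// mulrAC ler_pdivlMr//.
  rewrite (impulse_product_split tk_incr tk_lim c st).
  rewrite (impulse_product_split tk_incr tk_lim ak st) -!mulrA.
  apply: ler_wpM2l; first exact: ltW.
  rewrite mulrC; apply: ler_wpM2l; first exact: ltW.
  apply: ler_prod => k _; rewrite ltW ?(jump_ratio_gt0 tk bk_gt0 I_bound)//=.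
  by have /andP[] := jump_ratio_bounds tk I_bound x k.
have Qp0 t : 0 <= Q t / p t by rewrite divr_ge0// ltW.
have Z_ge0 t : t2 <= t -> 0 <= Z t.
  by move=> tt; rewrite mulr_ge0// ltW// y_sign// (le_trans t12).
have Z_le s t : t2 <= s -> s <= t -> Z t <= Z s.
  move=> t2s st; apply: ler_pM => //; last exact: Qp.
    by rewrite ltW// y_sign// (le_trans t12)// (le_trans t2s).
  exact: signed_le.
have [l Zl] : exists l : R, Z t @[t --> +oo] --> l.
  pose Z' t := - Z (Num.max t2 t).
  have ndZ' : {homo Z' : s t / s <= t}.
    move=> s t st; rewrite lerN2; apply: Z_le; first by rewrite le_max lexx.
    by rewrite ge_max !le_max lexx st !orbT.
  have ubZ' : has_ubound (range Z').
    by exists 0 => _ [t _ <-]; rewrite oppr_le0 Z_ge0// le_max lexx.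
  pose proof (cvgN (nondecreasing_cvgr ndZ' ubZ')) as H.
  exists (- sup (range Z')); apply: (cvg_near_eq H); near=> t.
  rewrite /= /Z' opprK max_r//; near: t; exact: (nbhs_pinfty_ge (num_real t2)).
have pP : p t @[t --> +oo] --> P.
  have : (\prod_(k < cnt t) ak k) @[t --> +oo] --> P.
    exact: (cvg_comp _ _ impulse_count_pinfty aP).
  move=> H; apply: (cvg_near_eq H); apply: nearW => t.
  by rewrite /impulse_product big_mkord.
exists (sg * (l * P)).
pose proof (cvgM (cvg_cst sg) (cvgM Zl pP)) as H; apply: (cvg_near_eq H); apply: nearW => t.
have cancel (u v z : R) : z != 0 -> sg * (sg * u * (v / z) * z) = sg * sg * (u * v).
  by move=> z0; field.
rewrite /Z /= /cst cancel ?gt_eqF// (impulse_freeK tk_lim bk_gt0 I_bound x t).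
by case: sg_norm => ->; rewrite ?mulrNN !mul1r.
Unshelve. all: by end_near. Qed.

(** Freezing Y before t2, where it need not be monotone, gives a function that is
    nonincreasing on the whole half-line. *)
Lemma frozen_signed_continuous :
  {within `[0, +oo[, continuous (glue t2 (fun=> Y t2) Y)}.
Proof.
have [Yr Yl] := signed_continuous.
have t02 : t0 <= t2 by rewrite (le_trans t01).
apply/continuous_within_itvcyP; split=> [t _|].
  apply/left_right_continuousP; split.
    rewrite {2}/glue; have [tt|tt] := leP t t2.
      apply: (cvg_near_eq (cvg_cst (Y t2))).
      by apply: filterS (nbhs_left_le t) => s st; rewrite /glue (le_trans st).
    apply: (cvg_near_eq (Yl t (le_lt_trans t02 tt))).
    by apply: filterS (nbhs_left_gt tt) => s st; rewrite /glue leNgt st.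
  rewrite {2}/glue; have [tt|tt] := ltP t t2.
    rewrite (ltW tt); apply: (cvg_near_eq (cvg_cst (Y t2))).
    by apply: filterS (nbhs_right_le tt) => s st; rewrite /glue st.
  have -> : (if t <= t2 then Y t2 else Y t) = Y t.
    by case: leP => // tt'; rewrite (le_anti (_ : t <= t2 <= t))// tt'.
  apply: (cvg_near_eq (Yr t (le_trans t02 tt))).
  by apply: filterS (nbhs_right_gt t) => s st; rewrite /glue leNgt (le_lt_trans tt).
rewrite {2}/glue t2_ge0; apply: (cvg_near_eq (cvg_cst (Y t2))).
apply: filterS (nbhs_right_le (lt_le_trans ltr01 t2_ge1)) => s st.
by rewrite /glue st.
Qed.

(** The left derivative of Y is at most - |f| / Q, and Q <= Pm. *)
Lemma feedback_integral_bound (v u : R) : t2 + 1 <= v -> v < u ->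
  measurable_fun `[v, u] (fun s => f s (segment x s)) ->
  (\int[mu]_(s in `[v, u]) `|f s (segment x s)|%:E <= (Pm * Y t2)%:E)%E.
Proof.
move=> tv vu mg; pose Yc := glue t2 (fun=> Y t2) Y.
have Yc0 : Yc 0 = Y t2 by rewrite /Yc /glue t2_ge0.
rewrite -Yc0; apply: (@left_derivative_integral_bound _ Yc _ _ _ _ (range tk)) => //.
- move=> t _; rewrite /Yc /glue; case: (leP t t2) => tt; apply/ltW/y_sign => //.
  by rewrite (le_trans t12)// ltW.
- exact: frozen_signed_continuous.
- move=> s t _ st; rewrite /Yc /glue; have [tt|tt] := leP t t2.
    by rewrite (le_trans st tt).
  by case: (leP s t2) => st2; apply: signed_le => //; exact: ltW.
- by apply: (sub_countable (card_image_le _ _)); exact: countableP.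
- exact: ltW.
- by rewrite (le_trans t2_ge1)// (le_trans _ tv)// lerDl.
move=> s /andP[ts su] stk.
have t2s : t2 < s by rewrite (lt_le_trans _ ts)// (lt_le_trans _ tv)// ltrDl.
have t1s : t1 < s by rewrite (le_lt_trans t12).
have [l Yl lE] := signed_left_derivative t1s stk.
exists l.
  apply: (has_left_derivative_eq_near _ _ Yl).
    by apply: filterS (nbhs_left_gt t2s) => r tr; rewrite /Yc /glue leNgt tr.
  by rewrite /Yc /glue leNgt t2s.
have s0 : 0 <= s by rewrite (le_trans t2_ge0)// ltW.
have aY : 0 <= a s * (sg * y s) by rewrite mulr_ge0 ?a_ge0// ltW// y_sign// ltW.
have sf := feedback_opposes_sign (ltW t2s).
have fE : `|f s (segment x s)| = - (sg * f s (segment x s)).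
  rewrite -[LHS]mul1r -(_ : `|sg| = 1); last by case: sg_norm => ->; rewrite ?normrN normr1.
  by rewrite -normrM ler0_norm.
have lQ : l * Q s <= sg * f s (segment x s).
  rewrite -ler_pdivlMr// -lE; by rewrite lerDl.
have l0 : l <= 0.
  rewrite -(pmulr_lle0 _ (Q_gt0 s)); exact: le_trans lQ sf.
rewrite fE lerN2; apply: le_trans lQ; rewrite mulrC.
apply: ler_wnM2l => //; exact: jump_product_le.
Qed.

(** Suppose c != 0 and let w be 0 up to some late impulse time tk m and x after it.
    Cutting at an impulse time puts the jump of w where breakpoints are allowed,
    and w meets all the requirements of [diverging_integrals].  But at late times f
    along w is f along x, whose integral is bounded by
    [feedback_integral_bound]. *)
Lemma limit_zero (M c : R) : diverging_integrals tau f tk ->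
  (forall t, t0 <= t -> `|x t| <= M) -> x t @[t --> +oo] --> c -> c = 0.
Proof.
move=> divf xM xc; apply/eqP; apply: contrapT => /negP c0.
have [_ xl xr _ _] := x_sol.
have [m t2m] := tk_unbounded tk_lim t2.
have tm0 : 0 <= tk m by rewrite (le_trans t2_ge0).
have t0m : t0 <= tk m by rewrite (le_trans t01)// (le_trans t12).
have M0 : 0 <= M by rewrite (le_trans _ (xM t0 (lexx _))).
pose w := glue (tk m) (fun=> 0) x.
have wx t : tk m < t -> w t = x t by move=> mt; rewrite /w /glue leNgt mt.
have w0 t : t <= tk m -> w t = 0 by move=> mt; rewrite /w /glue mt.
have w_left t : tk m < t -> \forall s \near t^'-, x s = w s.
  by move=> mt; apply: filterS (nbhs_left_gt mt) => s ms; rewrite wx.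
have w_left0 t : t <= tk m -> \forall s \near t^'-, 0 = w s.
  by move=> mt; apply: filterS (nbhs_left_le t) => s ms; rewrite w0// (le_trans ms).
have x_cont t : tk m < t -> (forall k, t != tk k) -> x s @[s --> t] --> x t.
  move=> mt ttk; have t0t : t0 < t by rewrite (le_lt_trans t0m).
  by apply/left_right_continuousP; split; [exact: xl|apply: xr => //; exact: ltW].
have cst_PC (al be : R) : PC_on al be (fun=> 0 : R).
  split; first split.
  - by exists [::] => t _ _; exact: cvg_cst.
  - by move=> t _; apply/cvg_ex; exists 0; exact: cvg_cst.
  - by move=> t _; apply/cvg_ex; exists 0; exact: cvg_cst.
  - by move=> t _; exact: cvg_cst.
have xm t : tk m < t -> x t != 0.
  move=> mt; have ys := y_sign (le_trans (le_trans t12 t2m) (ltW mt)).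
  rewrite (impulse_freeK tk_lim bk_gt0 I_bound x t) mulf_neq0//; last by rewrite gt_eqF.
  by apply: contraTneq ys => ->; rewrite mulr0 ltxx.
(* the first six goals are the requirements on w *)
have [||||||T0 [T00 _ gint glim]] := divf w c.
- exists M => t _; have [tm|mt] := leP t (tk m); first by rewrite w0// normr0.
  by rewrite wx// xM// (le_trans t0m)// ltW.
- move=> [_ /(_ (tk m + 1))[t mt]]; have mt' : tk m < t by rewrite (lt_le_trans _ mt)// ltrDl.
  by move=> wt; have := xm t mt'; rewrite -wx// wt eqxx.
- split=> [b b0|t t_gt0 ttk].
    apply: (@PC_on_restrict _ 0 (Num.max b (tk m))) => //; first by rewrite le_max lexx.
    apply: PC_on_glue => //; first by rewrite le_max lexx orbT.
    exact: (PC_on_restrict t0m (lexx _) (solution_PC tk_incr tk_lim x_sol _)).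
  have [tm|mt|tm] := ltgtP t (tk m); last by have := ttk m; rewrite tm eqxx.
    split.
      rewrite w0 ?ltW//; apply: (cvg_near_eq (cvg_cst 0)).
      by apply: filterS (lt_nbhsl tm) => s sm; rewrite w0// ltW.
    exists 0; apply: (@has_left_derivative_eq_near _ (fun=> 0)).
    + exact/w_left0/ltW.
    + by rewrite w0// ltW.
    + by apply: (cvg_near_eq (cvg_cst 0)); apply: nearW => h; rewrite subrr mul0r.
  split.
    rewrite wx//; apply: (cvg_near_eq (x_cont t mt ttk)).
    by apply: filterS (lt_nbhsr mt) => s ms; rewrite wx.
  have t0t : t0 < t by rewrite (le_lt_trans t0m).
  have [_ _ _ _ /(_ t t0t ttk)[d xd _]] := x_sol.
  exists d; apply: has_left_derivative_eq_near xd; first exact: w_left.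
  by rewrite wx.
- move=> k t l; rewrite in_itv/= => /andP[kt tk1] wl.
  have [tm|mt] := leP t (tk m); first by rewrite w0// mulr0.
  have ttk j : t != tk j.
    have [jk|kj] := leqP j k; first by rewrite gt_eqF// (le_lt_trans _ kt)// tk_le.
    by rewrite lt_eqF// (lt_le_trans tk1)// tk_le.
  have t2t : t2 <= t by rewrite (le_trans t2m)// ltW.
  have t0t : t0 < t by rewrite (le_lt_trans t0m).
  have [_ _ _ _ /(_ t t0t ttk)[d xd dE]] := x_sol.
  have wd : has_left_derivative w t d.
    by apply: has_left_derivative_eq_near xd; [exact: w_left|rewrite wx].
  rewrite wx// (has_left_derivative_unique wl wd).
  have sf := feedback_opposes_sign t2t.
  have ys : 0 < sg * y t by apply: y_sign; rewrite (le_trans t12).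
  have sx : 0 < sg * x t.
    by rewrite (impulse_freeK tk_lim bk_gt0 I_bound x t) mulrA mulr_gt0.
  have t_ge0 : 0 <= t by rewrite (le_trans t2_ge0).
  have dE' : d * x t = (sg * f t (segment x t)) * (sg * x t) - a t * (x t * x t).
    rewrite -dE; case: sg_norm => ->; ring.
  rewrite dE' subr_le0 (@le_trans _ _ 0)//; first by rewrite mulr_le0_ge0// ltW.
  by rewrite mulr_ge0 ?a_ge0// -expr2 sqr_ge0.
- apply: (cvg_near_eq xc); apply: filterS (nbhs_pinfty_gt (num_real (tk m))) => t mt.
  by rewrite wx.
- exact: c0.
have [S [_ HS]] : \forall t \near +oo, tk m + 1 <= t - tau t.
  by have /cvgryPge := tau_lim; apply.
pose g s := f s (segment w s).
(* windows of times after T2 lie beyond tk m, so that w and x have the same history *)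
pose T2 := Num.max (t2 + 1) (Num.max T0 (S + 1)).
have T2t2 : t2 + 1 <= T2 by rewrite le_max lexx.
have T02 : T0 <= T2 by rewrite !le_max lexx orbT.
have ST2 : S < T2 by rewrite (@lt_le_trans _ _ (S + 1)) ?ltrDl// !le_max lexx !orbT.
have gE s : T2 <= s -> g s = f s (segment x s).
  move=> Ts; apply: f_hist.
    by rewrite (le_trans T00)// (le_trans T02).
  move=> th; rewrite in_itv/= => /andP[th1 _]; apply: wx.
  have : tk m + 1 <= s - tau s by apply: HS; rewrite (lt_le_trans ST2).
  by lra.
have mg u : T0 <= u -> measurable_fun `[T0, u] g.
  by move=> Tu; have /integrableP[/measurable_EFinP] := gint u Tu.
pose K0 := (\int[mu]_(s in `[T0, T2[) `|(g s)%:E|)%E.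
have K0fin : K0 \is a fin_num.
  rewrite ge0_fin_numE ?integral_ge0//.
  have /integrableP[_] := gint T2 T02; apply: le_lt_trans.
  apply: ge0_subset_integral => //.
    by apply: measurableT_comp => //; apply/measurable_EFinP; exact: mg.
  by apply: subset_itvl; rewrite bnd_simp.
have bound u : T2 < u ->
    (`|\int[mu]_(s in `[T0, u]) (g s)%:E| <= (fine K0 + Pm * Y t2)%:E)%E.
  move=> Tu; have T0u : T0 <= u by rewrite (le_trans T02)// ltW.
  have mgu : measurable_fun `[T0, u] (fun s => `|(g s)%:E|)%E.
    by apply: measurableT_comp => //; apply/measurable_EFinP; exact: mg.
  apply: le_trans (le_abse_integral _ _ _) _ => //.
    by apply/measurable_EFinP; exact: mg.
  have -> : `[T0, u]%classic = `[T0, T2[ `|` `[T2, u].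
    by rewrite -itv_bndbnd_setU ?bnd_simp// ltW.
  rewrite ge0_integral_setU//=; last 2 first.
  - by rewrite -itv_bndbnd_setU ?bnd_simp// ltW.
  - by apply/disj_setPS => s /=; rewrite !in_itv/= => -[/andP[_ h1] /andP[h2 _]]; have := lt_le_trans h1 h2; rewrite ltxx.
  rewrite EFinD fineK//; apply: leeD => //.
  rewrite [leLHS](_ : _ = \int[mu]_(s in `[T2, u]) `|f s (segment x s)|%:E)%E; last first.
    by apply: eq_integral => s; rewrite inE/= in_itv/= => /andP[Ts _]; rewrite gE.
  apply: feedback_integral_bound => //.
  apply: (@eq_measurable_fun _ _ _ _ _ g).
    by move=> s; rewrite inE/= in_itv/= => /andP[Ts _]; rewrite gE.
  apply: measurable_funS (mg u T0u) => //.
  by apply: subset_itvr; rewrite bnd_simp.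
pose K := fine K0 + Pm * Y t2.
pose I u := (\int[mu]_(s in `[T0, u]) (g s)%:E)%E.
have late : \forall u \near +oo, T2 < u by exact: (nbhs_pinfty_gt (num_real T2)).
have [c_gt0|c_lt0|c_eq0] := ltgtP 0 c; last by move: c0; rewrite c_eq0 eqxx.
  have /cvgeNyPle/(_ (- (K + 1))) H : I u @[u --> +oo] --> -oo%E.
    by move: glim; rewrite gtr0_sg// EFinN mulN1e.
  have [u [uT2 Iu]] := filter_ex (filterI late H).
  have := bound u uT2; rewrite leNgt => /negP; apply.
  apply: (@lt_le_trans _ _ (- (I u))%E).
    by rewrite lteNr (le_lt_trans Iu)// -EFinN lte_fin /K; lra.
  by rewrite -abseN lee_abs.
have /cvgeyPge/(_ (K + 1)) H : I u @[u --> +oo] --> +oo%E.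
  by move: glim; rewrite ltr0_sg// opprK mul1e.
have [u [uT2 Iu]] := filter_ex (filterI late H).
have := bound u uT2; rewrite leNgt => /negP; apply.
apply: (@lt_le_trans _ _ (I u)); last exact: lee_abs.
by rewrite (lt_le_trans _ Iu)// lte_fin /K; lra.
Qed.

End eventual_sign.

Lemma solution_vanishes x (g : R -> R) :
  (forall t, `|impulse_free I_ bk tk_lim x t| = `|g t|) ->
  g t @[t --> +oo] --> (0 : R) -> x t @[t --> +oo] --> (0 : R).
Proof.
move=> yg g0; apply/cvgrPdist_le => e e0.
have e'0 : 0 < e / Pm by rewrite divr_gt0.
pose proof (cvgr_dist_le _ _ g0 _ e'0) as H; apply: filterS H => t.
rewrite !sub0r !normrN -yg => yt.
have Qt := jump_product_gt0 tk_lim bk_gt0 I_bound x t.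
rewrite (impulse_freeK tk_lim bk_gt0 I_bound x t) normrM (gtr0_norm Qt).
rewrite -(divfK (lt0r_neq0 Pm_gt0) e).
by apply: ler_pM => //; [exact: ltW|exact: jump_product_le].
Qed.

Hypothesis damping_or_divergence :
  (\int[mu]_(u in `[0%R, +oo[) (a u)%:E = +oo)%E \/
  (cvg ((\prod_(k < n) ak k) @[n --> \oo]) /\ diverging_integrals tau f tk).

Lemma eventual_sign_vanishes t0 phi x sg t1 : 0 <= t0 -> BPC phi ->
  is_solution a f tk I_ t0 phi x -> sg = 1 \/ sg = -1 ->
  (forall t, t1 <= t -> 0 < sg * impulse_free I_ bk tk_lim x t) ->
  x t @[t --> +oo] --> (0 : R).
Proof.
move=> t00 bphi xsol sgn ysg; pose t1' := Num.max t0 t1.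
have t01 : t0 <= t1' by rewrite le_max lexx.
have ysg' t : t1' <= t -> 0 < sg * impulse_free I_ bk tk_lim x t.
  by rewrite ge_max => /andP[_]; exact: ysg.
have [S _ HS] := eventually_shift T tau_lim t1'.
pose t2 := Num.max 1 (Num.max t1' S).
have t21 : 1 <= t2 by rewrite le_max lexx.
have t12 : t1' <= t2 by rewrite le_max [X in _ || X]le_max lexx orbT.
have win t : t2 <= t -> t1' <= t - tau t.
  by rewrite ge_max => /andP[_]; rewrite ge_max => /andP[_]; exact: HS.
case: damping_or_divergence => [aoo|[/cvg_ex[P aP] divf]].
  apply: (@solution_vanishes x (fun t => sg * impulse_free I_ bk tk_lim x t)).
    by move=> t; case: sgn => ->; rewrite ?mulN1r ?normrN ?mul1r.
  exact: (vanishing_damped xsol sgn t01 ysg' t21 t12 win aoo).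
have [l xl] := signed_solution_cvg xsol sgn t01 ysg' t21 t12 win aP.
have [C _ HC] := solution_bound t00.
have [_ [M phiM]] := bphi.
have l0 : l = 0.
  apply: (limit_zero xsol sgn t01 ysg' t21 t12 win divf _ xl).
  apply: (HC phi x (Num.max 1 M)) => //; first by rewrite lt_max ltr01.
  by move=> s s0; rewrite le_max phiM ?orbT.
by rewrite -l0.
Qed.

(** Either y eventually keeps a strict sign, or it is nonnegative at arbitrarily late
    times and also nonpositive at arbitrarily late times. *)
Lemma solutions_attractive : globally_attractive a f tk I_.
Proof.
move=> t0 phi x t00 bphi xsol.
pose y := impulse_free I_ bk tk_lim x.
have [high|/existsNP[t1 H1]] := pselect (forall t : R, exists2 s, t <= s & 0 <= y s); last first.
  apply: (@eventual_sign_vanishes t0 phi x (-1) t1) => //; first by right.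
  move=> t t1t; rewrite mulN1r oppr_gt0 ltNge; apply/negP => yt.
  by apply: H1; exists t.
have [low|/existsNP[t1 H1]] := pselect (forall t : R, exists2 s, t <= s & y s <= 0); last first.
  apply: (@eventual_sign_vanishes t0 phi x 1 t1) => //; first by left.
  move=> t t1t; rewrite mul1r ltNge; apply/negP => yt.
  by apply: H1; exists t.
have [E [cE Etk fE adm1 adm2]] := exceptional_set.
have [dy2 dy1] := impulse_free_delay_inequality tau_ge0 tk_incr tk_lim bk_gt0
  I_bound lam_ge0 f_bound t00 bphi xsol Etk fE.
have cy : continuous_from t0 y by exact: impulse_free_continuous xsol.
have [C C0 HC] := impulse_free_bound t00.
have [_ [M phiM]] := bphi.
have M0 : 0 < Num.max 1 M by rewrite lt_max ltr01.
have yM t : t0 <= t -> `|y t| <= C * Num.max 1 M.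
  apply: (HC phi) => // s s0; by rewrite le_max phiM ?orbT.
apply: (@solution_vanishes x y) => //.
apply: (@delay_oscillation_vanishes _ tau a T t0 E t00 tau_ge0 tau_mono tau_lim
  a_ge0 a_cont T_ge0 T_tau cE L1 L2 al1 al2 y (C * Num.max 1 M) adm1 adm2 alpha12
  dy2 dy1 cy low high).
- by rewrite mulr_ge0// ltW.
- by exists t0 => t /yM; rewrite ler_norml => /andP[].
Qed.

End stability.

Theorem theorem2p2 (R : realType)
  (tau a : R -> R) (tk : nat -> R) (I_ : nat -> R -> R)
  (f : R -> (R -> R) -> R)
  (tau_ge0 : forall t, 0 <= t -> 0 <= tau t)
  (tau_cont : {within `[0, +oo[, continuous tau})
  (tau_lim : t - tau t @[t --> +oo] --> +oo)
  (tau_mono : forall s t, 0 <= s -> s <= t -> s - tau s <= t - tau t)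
  (tk_gt0 : forall k, 0 < tk k)
  (tk_incr : forall k, tk k < tk k.+1)
  (tk_lim : tk k @[k --> \oo] --> +oo)
  (a_ge0 : forall t, 0 <= t -> 0 <= a t)
  (a_cont : {within `[0, +oo[, continuous a})
  (I_cont : forall k, continuous (I_ k))
  (I_0 : forall k, I_ k 0 = 0)
  (f_hist : depends_on_history tau f)
  (f_0 : forall t, 0 <= t -> f t (fun=> 0) = 0)
  (f_cont : piecewise_continuous_BPC f)
  (f_wp : well_posed a f tk I_)
  (ak bk : nat -> R) (lam1 lam2 : R -> R) (T : R)
  (H1 : [/\ forall k, 0 < ak k, forall k, 0 < bk k &
            forall k x, bk k * x ^+ 2 <= x * (x + I_ k x) <= ak k * x ^+ 2])
  (H2 : ((exists M : R, forall n, `|\prod_(k < n) ak k| <= M) /\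
         (\int[@lebesgue_measure R]_(u in `[0%R, +oo[) (a u)%:E = +oo)%E) \/
        (cvg ((\prod_(k < n) ak k) @[n --> \oo]) /\
         diverging_integrals tau f tk))
  (H3 : [/\ forall t, 0 <= t -> 0 <= lam1 t /\ 0 <= lam2 t,
            piecewise_continuous_nneg lam1,
            piecewise_continuous_nneg lam2 &
            forall t phi, 0 <= t -> PC_at tau t phi ->
              - lam1 t * Mfun tau t phi <= f t phi
                <= lam2 t * Mfun tau t (fun th => - phi th)])
  (H4 : [/\ 0 < T, 0 <= T - tau T,
            alpha tau a tk bk T lam1 \is a fin_num,
            alpha tau a tk bk T lam2 \is a fin_num &
            (alpha tau a tk bk T lam1 * alpha tau a tk bk T lam2 < 1)%E]) :
  globally_asymptotically_stable a f tk I_.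
Proof.
have [ak0 bk0 Ib] := H1; have [lam0 lam1PC lam2PC fb] := H3.
have [T0 T_tau al1fin al2fin al12] := H4.
have [Pm Pm0 akP] : exists2 Pm : R, 0 < Pm & forall n, \prod_(k < n) ak k <= Pm.
  have [M HM] : exists M : R, forall n, `|\prod_(k < n) ak k| <= M.
    case: H2 => [[]//|[/cvg_seq_bounded [M [_ HM]] _]].
    by exists (M + 1) => n; apply: HM => //; rewrite ltrDl.
  exists (Num.max 1 M) => [|n]; first by rewrite lt_max ltr01.
  by rewrite le_max (le_trans (ler_norm _) (HM n)) orbT.
have al12' : fine (alpha tau a tk bk T lam1) * fine (alpha tau a tk bk T lam2) < 1.
  by rewrite -lte_fin EFinM !fineK.
split.
  exact: (solutions_stable tau_ge0 tau_cont tau_lim tau_mono tk_incr tk_lim a_ge0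
    a_cont I_0 f_cont bk0 Ib lam0 lam1PC lam2PC fb (ltW T0) T_tau al1fin al2fin
    al12' Pm0 akP).
apply: (solutions_attractive tau_ge0 tau_cont tau_lim tau_mono tk_incr tk_lim a_ge0
  a_cont I_0 f_hist f_cont ak0 bk0 Ib lam0 lam1PC lam2PC fb (ltW T0) T_tau al1fin
  al2fin al12' Pm0 akP).
by case: H2 => [[_ ?]|?]; [left|right].
Qed.
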